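(* Assume $R_0\in S_1(H)_+$. There exists a Borel kernel $T\mapsto\nu^T_{\mathrm{tr}}$ from $S_1(H)_+$ into probability measures on $\Omega$ such that: (1) For every Borel set $E\subset\Omega$, the map $T\mapsto\nu^T_{\mathrm{tr}}(E)$ is Borel, and $$\nu_{\mathrm{tr}}(E)=\int_{S_1(H)_+}\nu^T_{\mathrm{tr}}(E)\,d\mu_{\mathrm{tr}}(T).$$ (2) For $\mu_{\mathrm{tr}}$-almost every $T$, the measure $\nu^T_{\mathrm{tr}}$ is supported on the fiber $\{\omega:R_\infty(\omega)=T\}$ in the sense that $\nu^T_{\mathrm{tr}}(\{\omega:R_\infty(\omega)=T\})=1$. (3) For every $f\in L^1(\nu_{\mathrm{tr}})$, the conditional expectation onto $\mathcal{B}_{\mathrm{WR}}$ is given by $$\mathbb{E}_{\nu_{\mathrm{tr}}}[f\mid\mathcal{B}_{\mathrm{WR}}](\omega)=\int_\Omega f(\eta)\,d\nu^{R_\infty(\omega)}_{\mathrm{tr}}(\eta)\quad\text{for }\nu_{\mathrm{tr}}\text{-almost every }\omega.$$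
   Context: $H$ is a complex Hilbert space and $B(H)_+$ is the set of bounded positive operators on $H$; $S_1(H)$ is the trace class with norm $\|\cdot\|_1$, and $S_1(H)_+:=S_1(H)\cap B(H)_+$ carries the trace-norm topology and its Borel $\sigma$-algebra. Fix $m\ge1$, $R_0\in S_1(H)_+$ and contractions $C_1,\dots,C_m\in B(H)$. For finite words $w$ over $\{1,\dots,m\}$ (including the empty word $\emptyset$) define $R_\emptyset:=R_0$, $R_{wj}:=R_w^{1/2}(I-C_j^*C_j)R_w^{1/2}$, and $D_{w,j}:=R_w-R_{wj}=R_w^{1/2}C_j^*C_jR_w^{1/2}$; all of these are trace class. Path space: $\mathcal{A}:=\{0,1,\dots,m\}$, $\Omega:=\mathcal{A}^{\mathbb{N}}$ with the product topology and Borel $\sigma$-algebra; for a finite word $u$ over $\mathcal{A}$, $[u]$ is the cylinder of sequences with prefix $u$. If a finite word $u$ over $\mathcal{A}$ contains a $0$, set $R_u:=R_v$ with $v$ the prefix of $u$ before its first $0$. For $\omega\in\Omega$ let $\omega|n=\omega_1\cdots\omega_n$ ($\omega|0=\emptyset$) and $R_n(\omega):=R_{\omega|n}$. The sequence $R_n(\omega)$ is decreasing and $R_\infty(\omega)\in S_1(H)_+$ denotes its limit (in the strong operator topology, equivalently in trace norm); $R_\infty:\Omega\to S_1(H)_+$ is Borel. Trace-biased measure $\nu_{\mathrm{tr}}$: for $w\in\{1,\dots,m\}^*$ let $e^{(\mathrm{tr})}_{w,j}:=\mathrm{tr}(D_{w,j})$ and $s^{(\mathrm{tr})}_w:=\sum_{j=1}^me^{(\mathrm{tr})}_{w,j}$.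 If $s^{(\mathrm{tr})}_w>0$ put $p^{(\mathrm{tr})}_{w,0}:=0$, $p^{(\mathrm{tr})}_{w,j}:=e^{(\mathrm{tr})}_{w,j}/s^{(\mathrm{tr})}_w$ for $1\le j\le m$; if $s^{(\mathrm{tr})}_w=0$ put $p^{(\mathrm{tr})}_{w,0}:=1$, $p^{(\mathrm{tr})}_{w,j}:=0$ for $1\le j\le m$. If a finite word $u$ contains $0$, put $p^{(\mathrm{tr})}_{u,0}:=1$, $p^{(\mathrm{tr})}_{u,j}:=0$ for $1\le j\le m$. Then $\nu_{\mathrm{tr}}$ is the unique Borel probability measure on $\Omega$ with $\nu_{\mathrm{tr}}([\emptyset])=1$ and $\nu_{\mathrm{tr}}([ua])=\nu_{\mathrm{tr}}([u])\,p^{(\mathrm{tr})}_{u,a}$ for all finite words $u$ over $\mathcal{A}$ and $a\in\mathcal{A}$ (Kolmogorov extension). The WR boundary $\sigma$-field is $\mathcal{B}_{\mathrm{WR}}:=\sigma(R_\infty)$, and $\mu_{\mathrm{tr}}:=(R_\infty)_\#\nu_{\mathrm{tr}}$ is the law of $R_\infty$ under $\nu_{\mathrm{tr}}$, a Borel probability measure on $S_1(H)_+$. *)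

(* Defs.v *)
From HB Require Import structures.
From mathcomp Require Import all_boot all_order all_algebra.
From mathcomp Require Import complex.
From mathcomp Require Import all_classical all_reals all_analysis measurable_realfun.

Set Implicit Arguments.
Unset Strict Implicit.
Unset Printing Implicit Defensive.

Import Order.TTheory GRing.Theory Num.Theory.
Import numFieldNormedType.Exports.

Local Open Scope complex_scope.
Local Open Scope classical_set_scope.
Local Open Scope ring_scope.

HB.mixin Record isHilbert (R : realType) H & CompleteNormedModule R[i] H := {
  dotp : H -> H -> R[i];
  dotpDZl : forall (a : R[i]) (x y z : H),
    dotp (a *: x + y) z = a * dotp x z + dotp y z;
  dotpC : forall x y : H, dotp x y = (dotp y x)^*;
  dotp_norm : forall x : H, dotp x x = `|x| ^+ 2
}.

#[short(type="hilbertType")]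
HB.structure Definition Hilbert (R : realType) :=
  {H of CompleteNormedModule R[i] H & isHilbert R H}.

Section operators.
Context {R : realType} {H : hilbertType R}.
Implicit Types (A B : H -> H) (E : set H).

Definition bounded_op A : Prop :=
  linear A /\ exists M : R, forall x, `|A x| <= M%:C * `|x|.

(* In the order of R[i], 0 <= z means that z is real and nonnegative. *)
Definition positive_op A : Prop :=
  bounded_op A /\ forall x, 0 <= dotp (A x) x.

Definition contraction_op A : Prop :=
  bounded_op A /\ forall x, `|A x| <= `|x|.

Definition adjoint A : H -> H :=
  xget \0 [set B | bounded_op B /\ forall x y, dotp (A x) y = dotp x (B y)].

Definition sqrt_op A : H -> H :=
  xget \0 [set B | positive_op B /\ B \o B = A].

Definition abs_op A : H -> H := sqrt_op (adjoint A \o A).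

Definition orthonormal_basis E : Prop :=
  [/\ forall e, E e -> dotp e e = 1,
      forall e f, E e -> E f -> e <> f -> dotp e f = 0 &
      forall x, (forall e, E e -> dotp x e = 0) -> x = 0].

Definition onb : set H := xget set0 [set E | orthonormal_basis E].

(* Trace of a positive operator, possibly +oo; it does not depend on the
   orthonormal basis. *)
Definition trace_pos A : \bar R := \esum_(e in onb) (complex.Re (dotp (A e) e))%:E.

Definition tr A : R := fine (trace_pos A).

Definition trace_class A : Prop :=
  bounded_op A /\ (trace_pos (abs_op A) < +oo)%E.

Definition trace_norm A : R := tr (abs_op A).

End operators.

(* The cone S_1(H)_+ *)
Record pos_trace_class (R : realType) (H : hilbertType R) := PosTraceClass {
  pos_trace_class_op :> H -> H;
  pos_trace_class_positive : positive_op pos_trace_class_op;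
  pos_trace_class_trace : trace_class pos_trace_class_op
}.

Section pos_trace_class_topology.
Context {R : realType} {H : hilbertType R}.
Local Notation S1 := (pos_trace_class H).

Lemma dotp0l (z : H) : dotp 0 z = 0.
Proof.
have := dotpDZl 1 0 0 z; rewrite scaler0 addr0 mul1r => /eqP.
by rewrite eq_sym -subr_eq0 addrK => /eqP.
Qed.

Lemma dotp0r (z : H) : dotp z 0 = 0.
Proof. by rewrite dotpC dotp0l rmorph0. Qed.

Lemma positive_op0 : positive_op (\0 : H -> H).
Proof.
split=> [|x /=]; last by rewrite dotp0l.
split=> [a x y /=|]; first by rewrite scaler0 addr0.
by exists 0 => x /=; rewrite normr0 mul0r.
Qed.

Lemma adjoint0 : adjoint (\0 : H -> H) = \0.
Proof.
rewrite /adjoint; case: xgetP => [B _ [_ adB]|//].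
apply/funext => y /=; apply/eqP; rewrite -normr_eq0 -sqrf_eq0 -dotp_norm.
by rewrite -adB dotp0l.
Qed.

Lemma sqrt_op0 : sqrt_op (\0 : H -> H) = \0.
Proof.
rewrite /sqrt_op; case: xgetP => [B _ [[[linB _] posB] BB0]|//].
have BB x : B (B x) = 0 by rewrite -[LHS]/((B \o B) x) BB0.
apply/funext => x /=; apply/eqP; rewrite -normr_eq0 -sqrf_eq0 -dotp_norm.
apply/negPn/negP => a0; set a := dotp (B x) (B x) in a0.
pose b := dotp x (B x); pose c := - ((1 + b) / a).
have := posB (c *: B x + x).
rewrite linB BB scaler0 add0r dotpC dotpDZl -/a -/b.
by rewrite mulNr divfK// opprD addrNK rmorphN rmorph1 oppr_ge0 ler10.
Qed.

Lemma trace_class0 : trace_class (\0 : H -> H).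
Proof.
split; first exact: positive_op0.1.
rewrite /abs_op adjoint0 (_ : \0 \o \0 = \0)// sqrt_op0 /trace_pos esum1//.
by move=> e _ /=; rewrite dotp0l.
Qed.

Definition pos_trace_class0 : S1 := PosTraceClass positive_op0 trace_class0.

HB.instance Definition _ := gen_eqMixin S1.
HB.instance Definition _ := gen_choiceMixin S1.
HB.instance Definition _ := isPointed.Build S1 pos_trace_class0.

(* Open sets for the distance trace_norm (S \- T). *)
Definition trace_norm_open (U : set S1) : Prop :=
  forall T, U T -> exists2 e : R, 0 < e &
    forall S : S1, trace_norm (S \- T) < e -> U S.

Let trace_norm_openT : trace_norm_open setT.
Proof. by move=> T _; exists 1. Qed.

Let trace_norm_openI : setI_closed trace_norm_open.
Proof.
move=> U V oU oV T [/oU[e e0 eU] /oV[f f0 fV]].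
exists (Num.min e f); first by rewrite lt_min e0.
by move=> S; rewrite lt_min => /andP[/eU US /fV VS]; split.
Qed.

Let trace_norm_open_bigU (I : Type) (f : I -> set S1) :
  (forall i, trace_norm_open (f i)) -> trace_norm_open (\bigcup_i f i).
Proof.
move=> of_ T [i _ /(of_ i)[e e0 eU]].
by exists e => // S /eU fS; exists i.
Qed.

HB.instance Definition _ := isOpenTopological.Build S1
  trace_norm_openT trace_norm_openI trace_norm_open_bigU.

Lemma open_pos_trace_classE : open = trace_norm_open :> set (set S1).
Proof.
rewrite openE; apply/seteqP; split=> U /= UU T UT.
  have [V [oV VT VU]] := UU _ UT.
  have [e e0 eV] := oV _ VT.
  by exists e => // S /eV VS; exact: VU.
by exists U; split.
Qed.

End pos_trace_class_topology.

Notation borel T := (g_sigma_algebraType (@open T)).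

(* {0, 1, ..., m}; the letter j in {1, ..., m} is represented by
   lift ord0 j with j : 'I_m. *)
Definition alphabet (m : nat) : Type := 'I_m.+1.

HB.instance Definition _ m := Choice.on (alphabet m).
HB.instance Definition _ m := isPointed.Build (alphabet m) (ord0 : 'I_m.+1).
HB.instance Definition _ m := hasNbhs.Build (alphabet m) principal_filter.
HB.instance Definition _ m := Discrete_ofNbhs.Build (alphabet m) erefl.

Definition path_space (m : nat) : Type := prod_topology (fun _ : nat => alphabet m).

HB.instance Definition _ m := Pointed.copy (path_space m)
  (prod_topology (fun _ : nat => alphabet m)).
HB.instance Definition _ m := Topological.copy (path_space m)
  (prod_topology (fun _ : nat => alphabet m)).

Section WR_tree.
Context {R : realType} {H : hilbertType R} {m : nat}.
Variables (R0 : pos_trace_class H) (C : 'I_m -> H -> H).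
Implicit Types (w : seq 'I_m) (u : seq (alphabet m)) (omega : path_space m).

Definition residual_step (Q : H -> H) (j : 'I_m) : H -> H :=
  sqrt_op Q \o (idfun \- (adjoint (C j) \o C j)) \o sqrt_op Q.

Definition residual w : H -> H := foldl residual_step R0 w.

Definition increment w (j : 'I_m) : H -> H := residual w \- residual (rcons w j).

(* The prefix of u before its first 0, as a word over {1, ..., m}. *)
Definition live_prefix u : seq 'I_m :=
  pmap (unlift ord0) (take (index ord0 u) u).

Definition residual0 u : H -> H := residual (live_prefix u).

Definition path_prefix omega (n : nat) : seq (alphabet m) := mkseq omega n.

Definition cylinder u : set (path_space m) :=
  [set omega | path_prefix omega (size u) = u].

(* The default value R0 is never used: the strong limit always exists in
   S_1(H)_+ and is unique. *)
Definition residual_lim omega : pos_trace_class H :=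
  xget R0 [set T : pos_trace_class H | forall x : H,
    residual0 (path_prefix omega n) x @[n --> \oo] --> T x].

Definition edge_weight w (j : 'I_m) : R := tr (increment w j).

Definition total_weight w : R := \sum_(j < m) edge_weight w j.

Definition trans_prob u (a : alphabet m) : R :=
  if (ord0 : alphabet m) \in u then (a == ord0)%:R else
  let w := live_prefix u in
  if 0 < total_weight w then
    (if unlift ord0 a is Some j then edge_weight w j / total_weight w else 0)
  else (a == ord0)%:R.

Definition trace_biased (nu : set (borel (path_space m)) -> \bar R) : Prop :=
  nu (cylinder [::]) = 1%E /\
  forall u a, nu (cylinder (rcons u a)) = (nu (cylinder u) * (trans_prob u a)%:E)%E.

End WR_tree.

Section complex_integration.
Context {R : realType} {d : measure_display} {T : measurableType d}.
Implicit Types (mu : {measure set T -> \bar R}) (f g : T -> R[i]).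

Definition cintegrable mu f : Prop :=
  mu.-integrable setT (EFin \o (@complex.Re R \o f)) /\
  mu.-integrable setT (EFin \o (@complex.Im R \o f)).

Definition cintegral mu (A : set T) f : R[i] :=
  Complex (\int[mu]_(x in A) complex.Re (f x)) (\int[mu]_(x in A) complex.Im (f x)).

(* g is a version of the conditional expectation of f given the
   sub-sigma-algebra G. *)
Definition is_cond_exp mu (G : set (set T)) f g : Prop :=
  [/\ forall B : set R, measurable B ->
        G ((@complex.Re R \o g) @^-1` B) /\ G ((@complex.Im R \o g) @^-1` B),
      cintegrable mu g &
      forall A, G A -> cintegral mu A g = cintegral mu A f].

End complex_integration.

(* Main.v *)
Require Import Defs.
From HB Require Import structures.
From mathcomp Require Import all_boot all_order all_algebra.
From mathcomp Require Import complex ring lra.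
From mathcomp Require Import all_classical all_reals all_analysis measurable_realfun.

(* A path takes countably many values R_w before the limit, and along it the
   positive operators R_n decrease; by dominated convergence of the diagonal
   entries R_n converges to R_infty in trace norm.  Hence R_infty is a
   trace-norm limit of locally constant maps and is Borel, and its range lies
   in the closure of the countable set of all R_w: countably many balls
   separate the fibres, although S_1(H)_+ itself need not be separable.

   The kernel is built from the Radon-Nikodym densities of
   B |-> nu([u] n R_infty^-1(B)) with respect to the law mu of R_infty.  For
   mu-almost every T these densities are consistent cylinder weights, and they
   define a probability measure on the path space as the image of Lebesgue
   measure on [0, 1[ under the map that follows the nested subdivision of
   [0, 1[ into intervals of length the weight of u.  Concentration on the fibre
   follows by testing the separating balls, and the conditional expectation
   formula by testing indicators of R_infty^-1(B).

   The metric structure of S_1(H)_+ rests on square roots of positive operators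
   (monotone iteration) and on the symmetry J with D = J|D| for a bounded
   symmetric D, which gives tr|D| <= tr B whenever -B <= D <= B, hence the
   triangle inequality for the trace norm. *)

Set Implicit Arguments.
Unset Strict Implicit.
Unset Printing Implicit Defensive.

Import Order.TTheory GRing.Theory Num.Theory.
Import numFieldNormedType.Exports.

Local Open Scope complex_scope.
Local Open Scope classical_set_scope.
Local Open Scope ring_scope.

(** * Hilbert space *)

(** Two separate countability properties are at work. The kernel exists because the path space has
    only countably many cylinders: all almost-everywhere identities between densities hold off one
    null set, and on that set the kernel is the point mass at the path constantly 0, so that it is a
    probability for every T. Concentration on the fibres concerns the target instead, where
    countably many Borel sets separate points only near the range of R_infty. The operator theory
    avoids spectral measures. Cauchy-Schwarz for the form of a positive A with A <= c gives |A x|^2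
    <= c <A x, x>, which turns monotone convergence of real numbers into strong convergence of
    operators. The symmetry J is needed because -B <= D <= B does not imply |D| <= B. Testing the
    form at x + J x and x - J x gives only 2 |D| <= B + J B J, but the trace does not see the
    conjugation by J. *)

Section inner_product.
Context {R : realType} {H : hilbertType R}.
Implicit Types (x y z : H) (r s : R).

(** The complex inner product is recovered from this real one by [dotpE], so estimates can stay in
    the ordered field [R]. *)
Definition ip x y : R := complex.Re (dotp x y).

Definition hnorm x : R := complex.Re `|x|.

Lemma ReD (a b : R[i]) : complex.Re (a + b) = complex.Re a + complex.Re b.
Proof. by case: a b => [? ?] [? ?]. Qed.

Lemma ReN (a : R[i]) : complex.Re (- a) = - complex.Re a.
Proof. by case: a. Qed.

Lemma dotpDl x y z : dotp (x + y) z = dotp x z + dotp y z.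
Proof. by rewrite -[x]scale1r dotpDZl mul1r scale1r. Qed.

Lemma dotpZl (a : R[i]) x z : dotp (a *: x) z = a * dotp x z.
Proof. by rewrite -[a *: x]addr0 dotpDZl dotp0l addr0. Qed.

Lemma dotpDr x y z : dotp x (y + z) = dotp x y + dotp x z.
Proof. by rewrite dotpC dotpDl rmorphD (dotpC x y) (dotpC x z). Qed.

Lemma dotpZr (a : R[i]) x z : dotp x (a *: z) = a^* * dotp x z.
Proof. by rewrite dotpC dotpZl rmorphM (dotpC x z). Qed.

Lemma dotpNl x z : dotp (- x) z = - dotp x z.
Proof. by rewrite -scaleN1r dotpZl mulN1r. Qed.

Lemma dotpBl x y z : dotp (x - y) z = dotp x z - dotp y z.
Proof. by rewrite dotpDl dotpNl. Qed.

Lemma hnormE x : `|x| = (hnorm x)%:C.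
Proof.
have := normr_ge0 x; rewrite /hnorm; case: `|x| => a b.
by rewrite lecE /= => /andP[/eqP ->].
Qed.

Lemma hnorm_ge0 x : 0 <= hnorm x.
Proof. by have := normr_ge0 x; rewrite hnormE lecE /= => /andP[]. Qed.

Lemma dotpp x : dotp x x = (hnorm x ^+ 2)%:C.
Proof. by rewrite dotp_norm hnormE rmorphXn. Qed.

Lemma ipxx x : ip x x = hnorm x ^+ 2.
Proof. by rewrite /ip dotpp. Qed.

Lemma ipC x y : ip x y = ip y x.
Proof. by rewrite /ip dotpC; case: (dotp y x). Qed.

Lemma ipDl x y z : ip (x + y) z = ip x z + ip y z.
Proof. by rewrite /ip dotpDl ReD. Qed.

Lemma ipDr x y z : ip x (y + z) = ip x y + ip x z.
Proof. by rewrite ipC ipDl ![ip _ x]ipC. Qed.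

Lemma ipNl x y : ip (- x) y = - ip x y.
Proof. by rewrite /ip dotpNl ReN. Qed.

Lemma ipNr x y : ip x (- y) = - ip x y.
Proof. by rewrite ipC ipNl ipC. Qed.

Lemma ipBl x y z : ip (x - y) z = ip x z - ip y z.
Proof. by rewrite ipDl ipNl. Qed.

Lemma ipBr x y z : ip x (y - z) = ip x y - ip x z.
Proof. by rewrite ipDr ipNr. Qed.

Lemma ip0l x : ip 0 x = 0.
Proof. by rewrite /ip dotp0l. Qed.

Lemma ip0r x : ip x 0 = 0.
Proof. by rewrite ipC ip0l. Qed.

Lemma ipZl r x y : ip (r%:C *: x) y = r * ip x y.
Proof. by rewrite /ip dotpZl; case: dotp => a b /=; rewrite mul0r subr0. Qed.

Lemma ipZr r x y : ip x (r%:C *: y) = r * ip x y.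
Proof. by rewrite ipC ipZl ipC. Qed.

Lemma hnorm_eq0 x : (hnorm x == 0) = (x == 0).
Proof. by rewrite -[RHS]normr_eq0 hnormE eq_complex /= eqxx andbT. Qed.

Lemma hnorm0 : hnorm 0 = 0.
Proof. by apply/eqP; rewrite hnorm_eq0. Qed.

Lemma hnorm_opp x : hnorm (- x) = hnorm x.
Proof. by rewrite /hnorm normrN. Qed.

Lemma hnormZ r x : hnorm (r%:C *: x) = `|r| * hnorm x.
Proof.
apply/eqP; rewrite -(@eqrXn2 _ 2)// ?mulr_ge0 ?hnorm_ge0//.
by rewrite exprMn real_normK ?num_real// -!ipxx ipZl ipZr mulrA expr2.
Qed.

Lemma hnorm_triangle x y : hnorm (x + y) <= hnorm x + hnorm y.
Proof. by have := ler_normD x y; rewrite !hnormE -rmorphD lecR. Qed.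

Lemma ip_eq0 x : (forall y, ip x y = 0) -> x = 0.
Proof.
by move=> /(_ x); rewrite ipxx => /eqP; rewrite sqrf_eq0 hnorm_eq0 => /eqP.
Qed.

Lemma ip_inj x y : (forall z, ip x z = ip y z) -> x = y.
Proof.
move=> xy; apply/eqP; rewrite -subr_eq0; apply/eqP/ip_eq0 => z.
by rewrite ipBl xy subrr.
Qed.

Lemma hnormB_sqr x y : hnorm (x - y) ^+ 2 = hnorm x ^+ 2 - 2 * ip x y + hnorm y ^+ 2.
Proof. by rewrite -!ipxx ipBl !ipBr [ip y x]ipC; ring. Qed.

(** By the sign of [c]: the minimum at [- b / c] gives the claim, a negative [c] is refuted at a
    large [t], and [c = 0] forces [b = 0]. *)
Lemma quadratic_ge0 (a b c : R) :
  (forall t, 0 <= a + 2 * t * b + t ^+ 2 * c) -> b ^+ 2 <= a * c.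
Proof.
move=> abc; have a0 : 0 <= a by have := abc 0; lra.
have [c0|c0|c0] := ltgtP 0 c.
- have := abc (- b / c); rewrite -(pmulr_lge0 _ c0).
  have -> : (a + 2 * (- b / c) * b + (- b / c) ^+ 2 * c) * c = a * c - b ^+ 2.
    by field; exact: lt0r_neq0.
  by rewrite subr_ge0.
- have [d d0 cd] : exists2 d, 0 < d & c = - d by exists (- c); rewrite ?opprK ?oppr_gt0.
  have bb : b <= `|b| by exact: ler_norm.
  have b0 : 0 <= `|b| by exact: normr_ge0.
  (* Chosen so that [c * u = c - 2 * e - a] with [u >= 1]; the polynomial at [u] is then at most
     [u * c], which is negative. *)
  set e := `|b| in bb b0; pose u := 1 + 2 * e / d + a / d.
  have cu : c * u = c - 2 * e - a by rewrite /u cd; field; exact: lt0r_neq0.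
  have u1 : 1 <= u.
    by rewrite /u -addrA lerDl addr_ge0// divr_ge0 ?mulr_ge0// ltW.
  have := abc u; have -> : u ^+ 2 * c = u * (c * u) by ring.
  by rewrite cu; nra.
- subst c; rewrite mulr0; have [->|b0] := eqVneq b 0; first by rewrite expr0n.
  have := abc (- (a + 1) / (2 * b)).
  have -> : a + 2 * (- (a + 1) / (2 * b)) * b + (- (a + 1) / (2 * b)) ^+ 2 * 0 = - 1.
    by field.
  by rewrite oppr_ge0 ler10.
Qed.

Lemma cauchy_schwarz x y : ip x y ^+ 2 <= hnorm x ^+ 2 * hnorm y ^+ 2.
Proof.
rewrite -!ipxx; apply: quadratic_ge0 => t.
have := sqr_ge0 (hnorm (x + t%:C *: y)).
by rewrite -ipxx !ipDl !ipDr !ipZl !ipZr [ip y x]ipC; congr (_ <= _); ring.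
Qed.

Lemma ip_le_hnorm x y : `|ip x y| <= hnorm x * hnorm y.
Proof.
rewrite -(@ler_pXn2r _ 2)// ?nnegrE ?mulr_ge0 ?hnorm_ge0//.
by rewrite exprMn real_normK ?num_real// cauchy_schwarz.
Qed.

Lemma cvg_hnorm (u : nat -> H) x :
  u n @[n --> \oo] --> x <-> hnorm (u n - x) @[n --> \oo] --> 0.
Proof.
split=> [/cvgrPdist_lt ux|/cvgrPdist_lt ux].
  apply/cvgrPdist_lt => e e0; have := ux e%:C; rewrite ltcR => /(_ e0).
  apply: filterS => n; rewrite -normrN opprB hnormE ltcR.
  by rewrite sub0r normrN ger0_norm// hnorm_ge0.
apply/cvgrPdist_lt => -[e e']; rewrite ltcE /= => /andP[/eqP -> e0].
apply: filterS (ux _ e0) => n; rewrite sub0r normrN ger0_norm ?hnorm_ge0// => une.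
by rewrite -normrN opprB hnormE ltcR.
Qed.

Lemma cvg_ip (u : nat -> H) x y :
  u n @[n --> \oo] --> x -> ip (u n) y @[n --> \oo] --> ip x y.
Proof.
move=> /cvg_hnorm ux; apply/cvgrPdist_le => e e0.
have e1 : 0 < e / (hnorm y + 1) by rewrite divr_gt0// ltr_wpDl ?hnorm_ge0.
move/cvgrPdist_le : ux => /(_ _ e1); apply: filterS => n.
rewrite sub0r normrN ger0_norm ?hnorm_ge0// -hnorm_opp opprB => une.
rewrite -ipBl (le_trans (ip_le_hnorm _ _))//.
rewrite ler_pdivlMr ?ltr_wpDl ?hnorm_ge0// in une.
apply: le_trans une; rewrite ler_wpM2l ?hnorm_ge0//.
by rewrite lerDl.
Qed.

Lemma cauchy_hnorm_cvg (u : nat -> H) :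
  (forall e, 0 < e -> exists N, forall n m, (N <= n)%N -> (n <= m)%N ->
    hnorm (u n - u m) < e) ->
  exists x : H, u n @[n --> \oo] --> x.
Proof.
move=> cu; apply/cvg_ex/cauchy_cvgP/cauchy_exP => -[e e'].
rewrite ltcE /= => /andP[/eqP -> e0].
have [N HN] := cu _ e0; exists (u N); exists N => // n Nn.
by rewrite -ball_normE /ball_/= hnormE ltcR HN.
Qed.

End inner_product.

(** * Bounded, symmetric and positive operators through their quadratic forms *)

Section operators.
Context {R : realType} {H : hilbertType R}.
Implicit Types (A B P Q : H -> H) (x y z : H) (r s c : R).

Lemma linearDop A : linear A -> {morph A : x y / x + y}.
Proof. by move=> linA x y; rewrite -[x in LHS]scale1r linA scale1r. Qed.

Lemma linear0op A : linear A -> A 0 = 0.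
Proof.
by move=> linA; have := linA (- 1) 0 0; rewrite scaler0 addr0 scaleN1r addNr.
Qed.

Lemma linearZop A : linear A -> forall (a : R[i]) x, A (a *: x) = a *: A x.
Proof. by move=> linA a x; rewrite -[a *: x]addr0 linA linear0op// addr0. Qed.

Lemma linearNop A : linear A -> {morph A : x / - x}.
Proof. by move=> linA x; rewrite -scaleN1r linearZop// scaleN1r. Qed.

Lemma linearBop A : linear A -> {morph A : x y / x - y}.
Proof. by move=> linA x y; rewrite linearDop// linearNop. Qed.

Lemma bounded_opP A : bounded_op A <->
  linear A /\ exists2 M, 0 < M & forall x, hnorm (A x) <= M * hnorm x.
Proof.
split=> -[linA [M]].
  move=> AM; split=> //; exists (`|M| + 1) => [|x]; first by rewrite ltr_wpDl.
  have := AM x; rewrite !hnormE -rmorphM lecR => /le_trans; apply.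
  by rewrite ler_wpM2r ?hnorm_ge0// (le_trans (ler_norm _))// lerDl.
by move=> _ AM; split=> //; exists M => x; rewrite !hnormE -rmorphM lecR.
Qed.

Lemma bounded_op_comp A B : bounded_op A -> bounded_op B -> bounded_op (A \o B).
Proof.
move=> /bounded_opP[linA [M M0 AM]] /bounded_opP[linB [N N0 BN]].
apply/bounded_opP; split=> [a x y /=|]; first by rewrite linB linA.
exists (M * N) => [|x /=]; first exact: mulr_gt0.
by rewrite (le_trans (AM _))// -mulrA ler_wpM2l// ltW.
Qed.

Lemma bounded_opD A B : bounded_op A -> bounded_op B -> bounded_op (A \+ B).
Proof.
move=> /bounded_opP[linA [M M0 AM]] /bounded_opP[linB [N N0 BN]].
apply/bounded_opP; split=> [a x y /=|].
  by rewrite linB linA scalerDr addrACA.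
exists (M + N) => [|x /=]; first exact: addr_gt0.
by rewrite (le_trans (hnorm_triangle _ _))// mulrDl lerD.
Qed.

Lemma bounded_opZ r A : bounded_op A -> bounded_op (fun x => r%:C *: A x).
Proof.
move=> /bounded_opP[linA [M M0 AM]]; apply/bounded_opP; split=> [a x y|].
  by rewrite linA scalerDr !scalerA mulrC.
exists ((`|r| + 1) * M) => [|x]; first by rewrite mulr_gt0// ltr_wpDl.
rewrite hnormZ -mulrA (le_trans (ler_wpM2l _ (AM x)))//.
by rewrite ler_wpM2r ?lerDl// mulr_ge0 ?hnorm_ge0// ltW.
Qed.

Lemma bounded_opB A B : bounded_op A -> bounded_op B -> bounded_op (A \- B).
Proof.
move=> bA /(bounded_opZ (- 1)) /(bounded_opD bA); congr bounded_op.
by apply/funext => x /=; rewrite rmorphN rmorph1 scaleN1r.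
Qed.

Lemma bounded_op_id : bounded_op (idfun : H -> H).
Proof. by split=> //; exists 1 => x; rewrite mul1r. Qed.

Lemma bounded_op_cvg A (u : nat -> H) x : bounded_op A ->
  u n @[n --> \oo] --> x -> A (u n) @[n --> \oo] --> A x.
Proof.
move=> /bounded_opP[linA [M M0 AM]] /cvg_hnorm ux; apply/cvg_hnorm.
apply: (@squeeze_cvgr _ _ _ _ (cst 0) (fun n => M * hnorm (u n - x))).
- by apply: nearW => n; rewrite hnorm_ge0 -linearBop//=.
- exact: cvg_cst.
- by rewrite -[X in _ --> X](mulr0 M); exact: cvgMr.
Qed.

(* Symmetry is stated for the real inner product Re <x, y>; for C-linear maps it
   is equivalent to complex symmetry, see bsym_dotp. *)
Definition bsym A := bounded_op A /\ forall x y, ip (A x) y = ip x (A y).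

Lemma dotpE x y : dotp x y = Complex (ip x y) (ip x ('i *: y)).
Proof.
rewrite /ip dotpZr; case: (dotp x y) => a b; apply/eqP; rewrite eq_complex /=.
by rewrite !(mul0r, mulN1r, mul1r, sub0r, opprK) !eqxx.
Qed.

Lemma bsym_dotp A : bsym A -> forall x y, dotp (A x) y = dotp x (A y).
Proof.
move=> [[linA _] sA] x y; rewrite !dotpE sA; congr Complex.
by rewrite sA linearZop.
Qed.

Lemma positive_opP A : positive_op A <-> bsym A /\ forall x, 0 <= ip (A x) x.
Proof.
split=> [[bA pA]|[[bA sA] pA]]; last first.
  split=> // x; rewrite lecE /= pA andbT.
  have := bsym_dotp (conj bA sA) x x; rewrite [RHS]dotpC => /eqP.
  by case: dotp => a b /=; rewrite eq_complex/= eqxx/= => /eqP ?; apply/eqP; lra.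
split; last by move=> x; have := pA x; rewrite lecE /= => /andP[].
split=> // x y; have [linA _] := bA.
have im0 z : complex.Im (dotp (A z) z) = 0.
  by have := pA z; rewrite lecE /= => /andP[/eqP].
have := im0 (x + 'i *: y); have := im0 x; have := im0 y.
rewrite linearDop// linearZop// !(dotpDl, dotpDr) !(dotpZl, dotpZr).
rewrite /ip [dotp x (A y)]dotpC.
case: (dotp (A x) x) => ? ?; case: (dotp (A x) y) => ? ?.
by case: (dotp (A y) x) => ? ?; case: (dotp (A y) y) => ? ? /=; lra.
Qed.

Lemma bsymD A B : bsym A -> bsym B -> bsym (A \+ B).
Proof.
by move=> [bA sA] [bB sB]; split=> [|x y /=]; [exact: bounded_opD|rewrite ipDl ipDr sA sB].
Qed.

Lemma bsymB A B : bsym A -> bsym B -> bsym (A \- B).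
Proof.
by move=> [bA sA] [bB sB]; split=> [|x y /=]; [exact: bounded_opB|rewrite ipBl ipBr sA sB].
Qed.

Lemma bsymZ r A : bsym A -> bsym (fun x => r%:C *: A x).
Proof.
by move=> [bA sA]; split=> [|x y /=]; [exact: bounded_opZ|rewrite ipZl ipZr sA].
Qed.

Lemma bsym_id : bsym idfun.
Proof. by split=> //; exact: bounded_op_id. Qed.

Lemma bsym_comp A B : bsym A -> bsym B -> (forall x, A (B x) = B (A x)) ->
  bsym (A \o B).
Proof.
move=> [bA sA] [bB sB] AB; split=> [|x y /=]; first exact: bounded_op_comp.
by rewrite sA sB AB.
Qed.

Lemma bsym_sqr A : bsym A -> bsym (A \o A).
Proof. by move=> sA; exact: bsym_comp. Qed.

Lemma bsym_iter n A : bsym A -> bsym (iter n A).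
Proof.
move=> sA; elim: n => [|n IH]; first exact: bsym_id.
by apply: bsym_comp => // x; rewrite -iterS iterSr.
Qed.

Lemma ip_sqr A x : bsym A -> ip (A (A x)) x = hnorm (A x) ^+ 2.
Proof. by move=> [_ sA]; rewrite sA ipxx. Qed.

Lemma positive_sqr A : bsym A -> positive_op (A \o A).
Proof.
move=> sA; apply/positive_opP; split; first exact: bsym_sqr.
by move=> x /=; rewrite ip_sqr// sqr_ge0.
Qed.

Lemma psd_cauchy_schwarz A x y : linear A -> (forall x y, ip (A x) y = ip x (A y)) ->
  (forall x, 0 <= ip (A x) x) ->
  ip (A x) y ^+ 2 <= ip (A x) x * ip (A y) y.
Proof.
move=> linA sA pA; apply: quadratic_ge0 => t.
have := pA (x + t%:C *: y); rewrite linearDop// linearZop//.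
rewrite !ipDl !ipDr !ipZl !ipZr [ip (A y) x]sA [ip y (A x)]ipC.
by congr (_ <= _); ring.
Qed.

(** Cauchy-Schwarz for the form of [A] at [x] and [A x] gives |A x|^4 <= <A x, x> c |A x|^2; then
    divide by |A x|^2. In operator terms, A^2 <= c A. *)
Lemma psd_hnorm_sqr A c x : linear A -> (forall x y, ip (A x) y = ip x (A y)) ->
  (forall x, 0 <= ip (A x) x) -> (forall x, ip (A x) x <= c * hnorm x ^+ 2) ->
  hnorm (A x) ^+ 2 <= c * ip (A x) x.
Proof.
move=> linA sA pA cA.
have := psd_cauchy_schwarz x (A x) linA sA pA; rewrite ipxx.
have := cA (A x); have := pA x.
set p := ip (A x) x; set q := ip _ _; set a := hnorm (A x) ^+ 2.
move=> p0 qa aa.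
have [a0|] := ltP 0 a; last first.
  move=> a0; have [c0|c0] := leP 0 c; first by rewrite (le_trans a0)// mulr_ge0.
  have x0 : x = 0.
    apply/eqP; rewrite -hnorm_eq0 -sqrf_eq0 eq_le sqr_ge0 andbT.
    by have := le_trans (pA x) (cA x); rewrite nmulr_rge0.
  by rewrite (le_trans a0)// /p x0 ip0r mulr0.
rewrite -(ler_pM2l a0) -expr2 (le_trans aa)// mulrCA.
by rewrite [leRHS]mulrA [_ * p]mulrC ler_wpM2l// mulrC.
Qed.
End operators.

(** * Strong limits of decreasing sequences of positive operators *)

Section monotone_limits.
Context {R : realType} {H : hilbertType R}.
Implicit Types (A B P Q : H -> H) (x y z : H) (r s c : R).

(** A pointwise limit inherits linearity, symmetry and a bound on its form; the operator bound
    follows by applying A^2 <= c A and then the form bound. *)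
Lemma psd_op_positive A c : 0 <= c -> linear A ->
  (forall x y, ip (A x) y = ip x (A y)) -> (forall x, 0 <= ip (A x) x) ->
  (forall x, ip (A x) x <= c * hnorm x ^+ 2) -> positive_op A.
Proof.
move=> c0 linA sA pA cA; apply/positive_opP; split=> //; split=> //.
apply/bounded_opP; split=> //; exists (c + 1) => [|x]; first by rewrite ltr_wpDl.
suff : hnorm (A x) <= c * hnorm x.
  by move=> /le_trans; apply; rewrite ler_wpM2r ?hnorm_ge0// lerDl.
rewrite -(@ler_pXn2r _ 2)// ?nnegrE ?mulr_ge0 ?hnorm_ge0//.
rewrite (le_trans (psd_hnorm_sqr _ linA sA pA cA))// exprMn expr2 -mulrA.
by rewrite ler_wpM2l.
Qed.

Lemma bounded_op_ip A : bounded_op A ->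
  exists2 c, 0 < c & forall x, ip (A x) x <= c * hnorm x ^+ 2.
Proof.
move=> /bounded_opP[linA [M M0 AM]]; exists M => // x.
rewrite (le_trans (ler_norm _))// (le_trans (ip_le_hnorm _ _))//.
by rewrite expr2 mulrA ler_wpM2r ?hnorm_ge0.
Qed.

(** For n <= k the difference D = A_n - A_k is positive with form at most c, so |D x|^2 <= c <D x,
    x>. The numbers <A_n x, x> decrease and are bounded below, hence A_n x is a Cauchy sequence. *)
Lemma decreasing_positive_cvg (A : nat -> H -> H) :
  (forall n, positive_op (A n)) ->
  (forall n x, ip (A n.+1 x) x <= ip (A n x) x) ->
  exists T, [/\ positive_op T, forall x, A n x @[n --> \oo] --> T x &
    forall n x, ip (T x) x <= ip (A n x) x].
Proof.
move=> pA dA.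
have linA n : linear (A n) by exact: (pA n).1.1.
have sA n x y : ip (A n x) y = ip x (A n y) by have /positive_opP[[]] := pA n.
have psA n x : 0 <= ip (A n x) x by have /positive_opP[] := pA n.
have dA' x : nonincreasing_seq (fun n => ip (A n x) x).
  by apply/nonincreasing_seqP => n; exact: dA.
have [c c0 A0c] := bounded_op_ip (pA 0%N).1.
have Ac n x : ip (A n x) x <= c * hnorm x ^+ 2 by rewrite (le_trans _ (A0c x))// dA'.
have cvgA x : exists l : H, A n x @[n --> \oo] --> l.
  apply: cauchy_hnorm_cvg => e e0.
  have cvgq : cvgn (fun n => ip (A n x) x).
    apply: nonincreasing_is_cvgn => //.
    by exists 0 => _ [n _ <-].
  set l := limn _ in cvgq.
  have ql n : l <= ip (A n x) x by exact: nonincreasing_cvgn_ge.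
  have ec : 0 < e ^+ 2 / c by rewrite divr_gt0// exprn_gt0.
  have /cvgrPdist_lt/(_ _ ec)[N _ HN] := cvgq.
  exists N => n k Nn nk.
  have := HN N (leqnn N); rewrite /= distrC ger0_norm ?subr_ge0// => qN.
  have -> : A n x - A k x = (A n \- A k) x by [].
  rewrite -(@ltr_pXn2r _ 2)// ?nnegrE ?hnorm_ge0// ?ltW//.
  have [[lind _] sd] : bsym (A n \- A k).
    by apply: bsymB; [have /positive_opP[] := pA n|have /positive_opP[] := pA k].
  apply: (@le_lt_trans _ _ (c * ip ((A n \- A k) x) x)).
    apply: psd_hnorm_sqr => //= y; rewrite ipBl; first by rewrite subr_ge0 dA'.
    by rewrite (le_trans _ (Ac n y))// gerBl.
  rewrite mulrC -ltr_pdivlMr//= ipBl (le_lt_trans _ qN)// lerB//.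
  exact: dA'.
have [T AT] := choice cvgA.
have sT x y : ip (T x) y = ip x (T y).
  apply: (cvg_unique _ (cvg_ip (y := y) (AT x))) => //.
  rewrite ipC (_ : (fun n => ip (A n x) y) = (fun n => ip (A n y) x)); first exact: cvg_ip.
  by apply/funext => n; rewrite sA ipC.
have pT x : 0 <= ip (T x) x.
  by apply: (cvgr_to_ge (cvg_ip (AT x))) => //; exact: nearW.
have TA n x : ip (T x) x <= ip (A n x) x.
  apply: (cvgr_to_le (cvg_ip (AT x))) => //; exists n => // k nk.
  exact: dA'.
exists T; split=> //; apply: (@psd_op_positive _ c) => //; first exact: ltW.
  move=> a x y; apply: (cvg_unique _ (AT (a *: x + y))) => //.
  rewrite (_ : (fun n => A n _) = (fun n => a *: A n x + A n y)); last first.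
    by apply/funext => n; rewrite linA.
  by apply: cvgD; [apply: cvgZr; exact: AT|exact: AT].
by move=> x; rewrite (le_trans (TA 0%N x)).
Qed.

(** Strong limits pass to products under a uniform norm bound: A_n B_n x = A_n b + A_n (B_n x - b).
    It serves to take the limit in the squares Y_n (Y_n x). *)
Lemma cvg_comp_contraction (A B : nat -> H -> H) (a b x : H) :
  (forall n, linear (A n)) -> (forall n z, hnorm (A n z) <= hnorm z) ->
  A n b @[n --> \oo] --> a -> B n x @[n --> \oo] --> b ->
  A n (B n x) @[n --> \oo] --> a.
Proof.
move=> linA cA Aa Bb.
have -> : (fun n => A n (B n x)) = (fun n => A n b + A n (B n x - b)).
  by apply/funext => n; rewrite linearBop// addrC subrK.
rewrite -[a]addr0; apply: cvgD => //; apply/cvg_hnorm.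
move/cvg_hnorm : Bb; apply: squeeze_cvgr; last exact: cvg_cst.
by apply: nearW => n; rewrite subr0 hnorm_ge0 cA.
Qed.

End monotone_limits.

(** * Square roots and absolute values *)

(* Vector identities become ring identities after pairing with a test vector. *)
Ltac hvec := apply: ip_inj => ?; rewrite ?(ipDl, ipNl, ipZl, ip0l); ring.

Section square_root.
Context {R : realType} {H : hilbertType R}.
Implicit Types (A B P Q X : H -> H) (x y z : H) (r s c : R).

(* Polynomials in B with nonnegative coefficients. *)
Inductive pos_poly B : (H -> H) -> Prop :=
| pos_poly0 : pos_poly B \0
| pos_polyS k r P of 0 <= r & pos_poly B P :
    pos_poly B (fun x => r%:C *: iter k B x + P x).

Lemma pos_polyD B P Q : pos_poly B P -> pos_poly B Q -> pos_poly B (P \+ Q).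
Proof.
move=> pP pQ; elim: pP => [|k r P' r0 _ IH].
  by rewrite (_ : \0 \+ Q = Q)//; apply/funext => x /=; rewrite add0r.
rewrite (_ : _ \+ Q = fun x => r%:C *: iter k B x + (P' \+ Q) x).
  exact: pos_polyS.
by apply/funext => x /=; rewrite addrA.
Qed.

Lemma pos_polyZ B P r : 0 <= r -> pos_poly B P -> pos_poly B (fun x => r%:C *: P x).
Proof.
move=> r0; elim=> [|k s P' s0 _ IH].
  by rewrite (_ : (fun _ => _) = \0)//; [exact: pos_poly0|apply/funext => x /=; rewrite scaler0].
rewrite (_ : (fun _ => _) = fun x => (r * s)%:C *: iter k B x + r%:C *: P' x).
  by apply: pos_polyS => //; exact: mulr_ge0.
by apply/funext => x /=; rewrite scalerDr scalerA -rmorphM.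
Qed.

Lemma pos_poly_id B : pos_poly B B.
Proof.
have := pos_polyS 1 (ler01 : 0 <= 1 :> R) (pos_poly0 B).
by congr pos_poly; apply/funext => x /=; rewrite scale1r addr0.
Qed.

Lemma linear_iter B k : linear B -> linear (iter k B).
Proof. by move=> linB; elim: k => // k IH a x y; rewrite !iterS IH linB. Qed.

Lemma pos_poly_iter B P k : linear B -> pos_poly B P -> pos_poly B (iter k B \o P).
Proof.
move=> linB; elim=> [|l r P' r0 _ IH].
  rewrite (_ : _ \o _ = \0); first exact: pos_poly0.
  by apply/funext => x /=; rewrite linear0op//; exact: linear_iter.
rewrite (_ : _ \o _ = fun x => r%:C *: iter (k + l) B x + (iter k B \o P') x).
  exact: pos_polyS.
by apply/funext => x /=; rewrite linear_iter// iterD.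
Qed.

Lemma pos_poly_comp B P Q : linear B -> pos_poly B P -> pos_poly B Q ->
  pos_poly B (P \o Q).
Proof.
move=> linB pP pQ; elim: pP => [|k r P' r0 _ IH]; first exact: pos_poly0.
have := pos_polyD (pos_polyZ r0 (pos_poly_iter k linB pQ)) IH.
by congr pos_poly.
Qed.

Lemma pos_poly_comm B P X : linear X -> (forall x, X (B x) = B (X x)) ->
  pos_poly B P -> forall x, X (P x) = P (X x).
Proof.
move=> linX XB; elim=> [|k r P' r0 _ IH] x /=; first exact: linear0op.
rewrite linX IH; congr (_ *: _ + _); elim: k x => //= k IHk x.
by rewrite XB IHk.
Qed.

Lemma pos_poly_bounded B P : bounded_op B -> pos_poly B P -> bounded_op P.
Proof.
move=> bB; elim=> [|k r P' r0 _ IH]; first exact: positive_op0.1.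
apply: bounded_opD => //; apply: bounded_opZ; elim: k => [|k IHk].
  exact: bounded_op_id.
exact: bounded_op_comp.
Qed.

(** Half of the power is moved to the other side of the inner product, which leaves the form of I or
    of B at a vector B^j x. *)
Lemma positive_op_iter B k : positive_op B -> positive_op (iter k B).
Proof.
move=> /positive_opP[sB pB]; apply/positive_opP; split=> [|x].
  exact: bsym_iter.
rewrite -(odd_double_half k) -addnn iterD iterD.
have [_ s2] := bsym_iter k./2 sB.
case: (odd k) => /=; last by rewrite s2 ipxx sqr_ge0.
by rewrite -iterS iterSr s2.
Qed.

Lemma pos_poly_positive B P : positive_op B -> pos_poly B P -> positive_op P.
Proof.
move=> pB; elim=> [|k r P' r0 _ /positive_opP[sP pP]]; first exact: positive_op0.
have /positive_opP[sk pk] := positive_op_iter k pB.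
apply/positive_opP; split; first by apply: bsymD => //; exact: bsymZ.
by move=> x; rewrite ipDl ipZl addr_ge0// mulr_ge0.
Qed.

Lemma pos_poly_commute B P Q : bounded_op B -> pos_poly B P -> pos_poly B Q ->
  forall x, P (Q x) = Q (P x).
Proof.
move=> bB pP pQ; have [linP _] := pos_poly_bounded bB pP.
apply: (pos_poly_comm linP _ pQ) => x; apply/esym.
by apply: (pos_poly_comm _ _ pP) => //; have [] := bB.
Qed.

(* The increasing iteration for the fixed point of Y = (B + Y^2) / 2, that is
   (I - Y)^2 = I - B. *)
Fixpoint sqrt_iter B n : H -> H :=
  if n is k.+1 then fun x => (2^-1)%:C *: (B x + sqrt_iter B k (sqrt_iter B k x))
  else \0.

Section contraction_case.
Variables (B : H -> H).
Hypotheses (pB : positive_op B) (cB : forall x, hnorm (B x) <= hnorm x).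
Let linB : linear B := pB.1.1.
Let half_ge0 : 0 <= 2^-1 :> R. Proof. by rewrite invr_ge0. Qed.

Lemma sqrt_iter_pos_poly n : pos_poly B (sqrt_iter B n).
Proof.
elim: n => [|n IH] /=; first exact: pos_poly0.
apply: (pos_polyZ half_ge0 (P := B \+ (sqrt_iter B n \o sqrt_iter B n))).
by apply: pos_polyD; [exact: pos_poly_id|exact: pos_poly_comp].
Qed.

Let linY n : linear (sqrt_iter B n).
Proof. exact: (pos_poly_bounded pB.1 (sqrt_iter_pos_poly n)).1. Qed.

(** The iterates commute, so Y_{n+2} - Y_{n+1} = (Y_{n+1} + Y_n)(Y_{n+1} - Y_n) / 2, and nonnegative
    coefficients propagate. Since B is positive, this gives monotonicity of the iteration. *)
Lemma sqrt_iter_increment n : pos_poly B (sqrt_iter B n.+1 \- sqrt_iter B n).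
Proof.
elim: n => [|n IH].
  rewrite (_ : _ \- _ = fun x => (2^-1)%:C *: B x).
    by apply: pos_polyZ => //; exact: pos_poly_id.
  by apply/funext => x /=; rewrite subr0 addr0.
have pD := pos_polyD (sqrt_iter_pos_poly n.+1) (sqrt_iter_pos_poly n).
have := pos_polyZ half_ge0 (pos_poly_comp linB pD IH).
congr pos_poly; apply/funext => x.
change ((2^-1)%:C *: (sqrt_iter B n.+1 (sqrt_iter B n.+1 x - sqrt_iter B n x) +
   sqrt_iter B n (sqrt_iter B n.+1 x - sqrt_iter B n x)) =
  (2^-1)%:C *: (B x + sqrt_iter B n.+1 (sqrt_iter B n.+1 x)) -
  (2^-1)%:C *: (B x + sqrt_iter B n (sqrt_iter B n x))).
rewrite -scalerBr; congr (_ *: _).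
have := pos_poly_commute pB.1 (sqrt_iter_pos_poly n) (sqrt_iter_pos_poly n.+1) x.
have := linY n; have := linY n.+1.
move: (sqrt_iter B n.+1) (sqrt_iter B n) => Y1 Y linY1 linY0 YY1.
by rewrite (linearBop linY1) (linearBop linY0) YY1; hvec.
Qed.

Lemma sqrt_iter_contraction n x : hnorm (sqrt_iter B n x) <= hnorm x.
Proof.
elim: n x => [|n IH] x /=; first by rewrite hnorm0 hnorm_ge0.
rewrite hnormZ ger0_norm// ler_pdivrMl// (le_trans (hnorm_triangle _ _))//.
by rewrite mulr_natl mulr2n lerD// (le_trans (IH _)).
Qed.

(** [Q] is the decreasing strong limit of I - Y_n. Whatever commutes with [B] commutes with every
    polynomial Y_n and hence with [Q]; uniqueness of square roots rests on this clause. *)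
Lemma sqrt_id_minus : exists Q, [/\ positive_op Q,
  forall x, Q (Q x) = x - B x &
  forall X, bounded_op X -> (forall x, X (B x) = B (X x)) ->
  forall x, X (Q x) = Q (X x)].
Proof.
have bY n : bsym (sqrt_iter B n).
  by have /positive_opP[] := pos_poly_positive pB (sqrt_iter_pos_poly n).
have pZ n : positive_op (idfun \- sqrt_iter B n).
  apply/positive_opP; split=> [|x]; first exact: bsymB (bsym_id) (bY n).
  rewrite ipBl subr_ge0 ipxx (le_trans (ler_norm _))//.
  rewrite (le_trans (ip_le_hnorm _ _))// expr2 ler_wpM2r ?hnorm_ge0//.
  exact: sqrt_iter_contraction.
have dZ n x : ip ((idfun \- sqrt_iter B n.+1) x) x <= ip ((idfun \- sqrt_iter B n) x) x.
  have /positive_opP[_ /(_ x)] := pos_poly_positive pB (sqrt_iter_increment n).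
  by rewrite ipBl => YY; rewrite !ipBl lerB// -subr_ge0.
have [Q [pQ ZQ _]] := decreasing_positive_cvg pZ dZ.
have YQ x : sqrt_iter B n x @[n --> \oo] --> x - Q x.
  rewrite (_ : (fun n => sqrt_iter B n x) = fun n => x - (x - sqrt_iter B n x)).
    by apply: cvgB; [exact: cvg_cst|exact: ZQ].
  by apply/funext => n; rewrite subKr.
exists Q; split=> // [x|X bX XB x].
- pose Y y := y - Q y.
  have YY : sqrt_iter B n (sqrt_iter B n x) @[n --> \oo] --> Y (Y x).
    by apply: (cvg_comp_contraction (b := Y x)) => //; exact: sqrt_iter_contraction.
  have Y2 : (2^-1)%:C *: (B x + Y (Y x)) = Y x.
    have YS : sqrt_iter B n.+1 x @[n --> \oo] --> Y x.
      by rewrite (cvg_shiftS (fun n => sqrt_iter B n x)); exact: YQ.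
    apply/esym; apply: (cvg_unique _ YS) => //.
    by apply: cvgZr; apply: cvgD => //; exact: cvg_cst.
  have {}Y2 : B x + Y (Y x) = Y x + Y x.
    have h : (2^-1 + 2^-1 : R) = 1 by field.
    by rewrite -[in RHS]Y2 -scalerDl -rmorphD h scale1r.
  have linQ : linear Q by exact: pQ.1.1.
  have {Y2} YY' : Y (Y x) = Y x + Y x - B x by rewrite -Y2 addrAC subrr add0r.
  have -> : Q (Q x) = Y (Y x) - x + Q x + Q x by rewrite /Y (linearBop linQ); hvec.
  by rewrite YY' /Y; hvec.
- apply: (cvg_unique _ (bounded_op_cvg bX (ZQ x))) => //.
  rewrite (_ : (fun n => _) = fun n => (idfun \- sqrt_iter B n) (X x)); first exact: ZQ.
  apply/funext => n /=; have [linX _] := bX.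
  by rewrite (linearBop linX) (pos_poly_comm linX XB (sqrt_iter_pos_poly n)).
Qed.
End contraction_case.

End square_root.

(** * Existence and uniqueness of square roots, and the polar symmetry of a symmetric operator *)

Section absolute_value.
Context {R : realType} {H : hilbertType R}.
Implicit Types (A B D N P Q X : H -> H) (x y z : H) (r s c : R).

Lemma psd_le1_contraction A : positive_op A ->
  (forall x, ip (A x) x <= hnorm x ^+ 2) ->
  forall x, hnorm (A x) ^+ 2 <= ip (A x) x.
Proof.
move=> /positive_opP[[[linA _] sA] pA] A1 x; rewrite -[leRHS]mul1r.
by apply: psd_hnorm_sqr => // y; rewrite mul1r.
Qed.

(** Rescaling by a form bound [c] makes B = I - A / c satisfy 0 <= B <= I; the root of I - B is then
    multiplied by the square root of [c]. *)
Lemma sqrt_op_exists A : positive_op A -> exists Q, [/\ positive_op Q,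
  forall x, Q (Q x) = A x &
  forall X, bounded_op X -> (forall x, X (A x) = A (X x)) ->
  forall x, X (Q x) = Q (X x)].
Proof.
move=> pA; have [c c0 Ac] := bounded_op_ip pA.1.
have cV0 : 0 < c^-1 by rewrite invr_gt0.
have /positive_opP[sA psA] := pA.
pose B := (idfun : H -> H) \- (fun x => (c^-1)%:C *: A x).
have B1 x : ip (B x) x <= hnorm x ^+ 2.
  by rewrite ipBl ipxx ipZl gerBl mulr_ge0// ltW.
have pB : positive_op B.
  apply/positive_opP; split; first by apply: bsymB; [exact: bsym_id|exact: bsymZ].
  by move=> x; rewrite ipBl ipxx ipZl subr_ge0 ler_pdivrMl.
have cB x : hnorm (B x) <= hnorm x.
  rewrite -(@ler_pXn2r _ 2)// ?nnegrE ?hnorm_ge0//.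
  exact: le_trans (psd_le1_contraction pB B1 x) (B1 x).
have [Q [pQ QQ cQ]] := sqrt_id_minus pB cB.
have /positive_opP[sQ psQ] := pQ.
have [linQ _] := pQ.1.
exists (fun x => (Num.sqrt c)%:C *: Q x); split.
- apply/positive_opP; split; first exact: bsymZ.
  by move=> x; rewrite ipZl mulr_ge0// sqrtr_ge0.
- move=> x; rewrite (linearZop linQ) scalerA -rmorphM -expr2 sqr_sqrtr ?ltW//.
  rewrite QQ /B /= opprB addrC subrK scalerA -rmorphM mulfV ?gt_eqF//.
  by rewrite scale1r.
- move=> X bX XA x; have [linX _] := bX; rewrite (linearZop linX) cQ// => y.
  by rewrite /B/= (linearBop linX) (linearZop linX) XA.
Qed.

Lemma psd_eq0 A x : positive_op A -> ip (A x) x = 0 -> A x = 0.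
Proof.
move=> /positive_opP[[[linA _] sA] pA] Ax0; apply/eqP.
rewrite -hnorm_eq0 -sqrf_eq0 -ipxx -sqrf_eq0 eq_le sqr_ge0 andbT.
by rewrite (le_trans (psd_cauchy_schwarz _ _ linA sA pA))// Ax0 mul0r.
Qed.

(** With y = P x - Q x, commutation gives (P + Q) y = P^2 x - Q^2 x = 0. Both forms then vanish at
    y, so P y = Q y = 0 and |y|^2 = <P y - Q y, x> = 0. *)
Lemma sqrt_unique P Q : positive_op P -> positive_op Q ->
  (forall x, P (P x) = Q (Q x)) -> (forall x, P (Q x) = Q (P x)) -> P = Q.
Proof.
move=> pP pQ PPQQ PQ; apply/funext => x.
have /positive_opP[[_ sP] psP] := pP; have /positive_opP[[_ sQ] psQ] := pQ.
set y := P x - Q x.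
have Py0 : ip (P y) y + ip (Q y) y = 0.
  rewrite -ipDl (linearBop pP.1.1) (linearBop pQ.1.1) PPQQ PQ.
  by rewrite addrC subrKA subrr ip0l.
have [P0 Q0] : P y = 0 /\ Q y = 0.
  have p0 := psP y; have q0 := psQ y.
  by split; apply: psd_eq0 => //; lra.
apply/eqP; rewrite -subr_eq0 -/y -hnorm_eq0 -sqrf_eq0 -ipxx {2}/y.
by rewrite ipBr -sP -sQ P0 Q0 ip0l subrr.
Qed.

(** Any positive root selected by [xget] commutes with its square [A], hence with the constructed
    root, and so equals it. *)
Lemma sqrt_opP A : positive_op A -> [/\ positive_op (sqrt_op A),
  forall x, sqrt_op A (sqrt_op A x) = A x &
  forall X, bounded_op X -> (forall x, X (A x) = A (X x)) ->
  forall x, X (sqrt_op A x) = sqrt_op A (X x)].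
Proof.
move=> pA; have [Q [pQ QQ cQ]] := sqrt_op_exists pA.
suff -> : sqrt_op A = Q by split.
rewrite /sqrt_op; case: xgetP => [B _ [pB BB]|/(_ Q) /=]; last first.
  by move=> /not_andP[//|]; apply: contra_notP => _; apply/funext => x /=.
have BBA x : B (B x) = A x by rewrite -BB.
by apply: sqrt_unique => // [|x]; [move=> x; rewrite BBA QQ|apply: cQ pB.1 _ _ => y; rewrite -!BBA].
Qed.

Lemma sqrt_op_unique A B : positive_op B -> (forall x, B (B x) = A x) -> sqrt_op A = B.
Proof.
move=> pB BB; have pA : positive_op A.
  rewrite (_ : A = B \o B); last by apply/funext => x /=.
  by apply: positive_sqr; have /positive_opP[] := pB.
have [pQ QQ cQ] := sqrt_opP pA; apply/esym/sqrt_unique => // x; first by rewrite BB QQ.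
by apply: cQ pB.1 _ x => y; rewrite -!BB.
Qed.

Lemma adjoint_bsym A : bsym A -> adjoint A = A.
Proof.
move=> sA; rewrite /adjoint; case: xgetP => [B _ [_ AB]|/(_ A)]; last first.
  by case/not_andP => [[]|]; [exact: sA.1|apply: contra_notP => _; exact: bsym_dotp].
apply/funext => x; apply: ip_inj => y.
by rewrite ipC [LHS]/ip -AB -/(ip (A y) x) sA.2 ipC.
Qed.

Lemma abs_opP D : bsym D -> [/\ positive_op (abs_op D),
  forall x, abs_op D (abs_op D x) = D (D x) &
  forall x, D (abs_op D x) = abs_op D (D x)].
Proof.
move=> sD; rewrite /abs_op adjoint_bsym//.
by have [pN NN cN] := sqrt_opP (positive_sqr sD); split=> //; apply: cN; first exact: sD.1.
Qed.

Lemma abs_op_positive A : positive_op A -> abs_op A = A.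
Proof.
move=> pA; have /positive_opP[sA _] := pA.
by rewrite /abs_op adjoint_bsym//; apply: sqrt_op_unique.
Qed.

Lemma abs_opB A B : bsym A -> bsym B -> abs_op (A \- B) = abs_op (B \- A).
Proof.
move=> sA sB; rewrite /abs_op !adjoint_bsym; [|exact: bsymB..].
congr sqrt_op; apply/funext => x /=.
rewrite !(linearBop sA.1.1) !(linearBop sB.1.1).
by hvec.
Qed.

(** Moving Q^k across the inner product, with k half of [n], reduces the claim at y = Q^k x to Q <=
    I for even [n] and to Q^2 <= Q for odd [n]. *)
Lemma positive_le1_iter_decreasing Q : positive_op Q ->
  (forall x, ip (Q x) x <= hnorm x ^+ 2) ->
  forall n x, ip (iter n.+1 Q x) x <= ip (iter n Q x) x.
Proof.
move=> pQ Q1 n x; have /positive_opP[sQ _] := pQ.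
set k := n./2; have [_ s] := bsym_iter k sQ; set y := iter k Q x.
have E j : ip (iter (k + (j + k)) Q x) x = ip (iter j Q y) y.
  by rewrite !iterD s.
have nE : n = (k + (odd n + k))%N by rewrite addnCA addnn odd_double_half.
rewrite [in leRHS]nE [in leLHS]nE -addnS -addSn !E.
case: (odd n) => /=; last by rewrite ipxx.
by rewrite sQ.2 ipxx psd_le1_contraction.
Qed.

(* J = 2 E - 1, where E = lim (1 - S^2 / c)^n is the projection onto the kernel
   of S = |D| - D. *)
Lemma polar_symmetry D : bsym D -> exists J : H -> H, [/\ bsym J,
  forall x, J (J x) = x, forall x, abs_op D (J x) = D x &
  forall x, J (abs_op D x) = D x].
Proof.
move=> sD; have [pN NN DN] := abs_opP sD; set N := abs_op D in pN NN DN *.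
have /positive_opP[sN _] := pN.
pose S := N \- D; have sS : bsym S by exact: bsymB.
have /positive_opP[sSS pSS] := positive_sqr sS.
have [c c0 Sc] := bounded_op_ip sSS.1.
have cV0 : 0 < c^-1 by rewrite invr_gt0.
pose Q := (idfun : H -> H) \- (fun x => (c^-1)%:C *: (S \o S) x).
have Q1 x : ip (Q x) x <= hnorm x ^+ 2.
  by rewrite ipBl ipxx ipZl gerBl mulr_ge0// ltW.
have pQ : positive_op Q.
  apply/positive_opP; split; first by apply: bsymB; [exact: bsym_id|exact: bsymZ].
  by move=> x; rewrite ipBl ipxx ipZl subr_ge0 ler_pdivrMl.
have [E [pE QE _]] := decreasing_positive_cvg (fun n => positive_op_iter n pQ)
  (positive_le1_iter_decreasing pQ Q1).
have /positive_opP[sE _] := pE.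
(* The limit is fixed by [Q], so S (S (E x)) = 0, and symmetry of [S] gives S (E x) = 0. *)
have SE x : S (E x) = 0.
  have QEx : Q (E x) = E x.
    have QS : iter n.+1 Q x @[n --> \oo] --> E x.
      by rewrite (cvg_shiftS (fun n => iter n Q x)); exact: QE.
    by apply: (cvg_unique _ (bounded_op_cvg pQ.1 (QE x))).
  have SS0 : S (S (E x)) = 0.
    move: QEx; rewrite /Q/= => /eqP; rewrite eq_sym -subr_eq0 subKr scaler_eq0.
    by rewrite eq_complex/= eqxx andbT gt_eqF//= => /eqP.
  by apply/eqP; rewrite -hnorm_eq0 -sqrf_eq0 -ip_sqr// SS0 ip0l.
have ES0 z : S z = 0 -> E z = z.
  move=> Sx; apply: (cvg_unique _ (QE z)) => //.
  rewrite (_ : (fun n => iter n Q z) = cst z); first exact: cvg_cst.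
  apply/funext; elim=> //= n ->; rewrite /Q/= Sx (linear0op sS.1.1).
  by rewrite scaler0 subr0.
have ES x : E (S x) = 0.
  by apply: ip_eq0 => y; rewrite sE.2 sS.2 SE ip0r.
(* S T = |D|^2 - D^2 = 0 puts the range of [T] in the kernel of [S], so E T = T = T E. As S E = 0
   means |D| E = D E, it follows that 2 |D| E = T E = |D| + D, that is, |D| J = D; the other order
   is symmetric. *)
pose T := N \+ D.
have sT : bsym T by exact: bsymD.
have ST x : S (T x) = 0.
  rewrite /S /T/= (linearDop sN.1.1) (linearDop sD.1.1) NN DN.
  by hvec.
have ET x : E (T x) = T x by exact: ES0.
have TE x : T (E x) = T x.
  by apply: ip_inj => y; rewrite sT.2 sE.2 ET sT.2.
exists (fun x => (2:R)%:C *: E x - x); split.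
- exact: bsymB (bsymZ 2 sE) bsym_id.
- move=> x; rewrite (linearBop sE.1.1) (linearZop sE.1.1).
  by rewrite (ES0 _ (SE x)); hvec.
- move=> x; rewrite (linearBop sN.1.1) (linearZop sN.1.1).
  have := TE x; have := SE x; rewrite /S /T/=.
  move=> /eqP; rewrite subr_eq0 => /eqP <- /(congr1 (fun z => z - N x)).
  by rewrite [N x + D x]addrC addrK => <-; hvec.
- move=> x; have := ET x; have := ES x; rewrite /S /T/=.
  rewrite (linearBop sE.1.1) (linearDop sE.1.1).
  move=> /eqP; rewrite subr_eq0 => /eqP <- /(congr1 (fun z => z - N x)).
  by rewrite [N x + D x]addrC addrK => <-; hvec.
Qed.

(** Since D = |D| J, this is Cauchy-Schwarz for the form of |D| at [J x] and [x]; that form takes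
    the same value at both vectors. *)
Lemma abs_op_ge D x : bsym D -> `|ip (D x) x| <= ip (abs_op D x) x.
Proof.
move=> sD; have [J [sJ JJ NJ JN]] := polar_symmetry sD.
have [pN _ _] := abs_opP sD; have /positive_opP[sN psN] := pN.
rewrite -(@ler_pXn2r _ 2)// ?nnegrE// real_normK ?num_real//.
rewrite -NJ (le_trans (psd_cauchy_schwarz _ _ sN.1.1 sN.2 psN))//.
by rewrite NJ -JN sJ.2 JJ -expr2.
Qed.

(** Polarization: the form of [D] at x + J x minus that at x - J x is 4 <D x, J x> = 4 <|D| x, x>,
    while in the sum of the two forms of [B] the cross terms cancel. *)
Lemma abs_op_le D B J : bsym D -> linear B ->
  bsym J -> (forall x, J (abs_op D x) = D x) -> (forall x, J (J x) = x) ->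
  (forall x, `|ip (D x) x| <= ip (B x) x) ->
  forall x, 2 * ip (abs_op D x) x <= ip (B x) x + ip (B (J x)) (J x).
Proof.
move=> sD linB sJ JN JJ DB x.
have := DB (x + J x); have := DB (x - J x); rewrite !ler_norml => /andP[le1 _] /andP[_].
move: le1; have [linD _] := sD.1.
rewrite !(linearBop linD, linearDop linD, linearBop linB, linearDop linB).
rewrite !(ipBl, ipDl, ipBr, ipDr).
have -> : ip (D x) (J x) = ip (abs_op D x) x by rewrite -JN sJ.2 JJ.
have -> : ip (D (J x)) x = ip (abs_op D x) x by rewrite sD.2 -JN sJ.2 JJ ipC.
by lra.
Qed.

End absolute_value.

(** * Orthonormal bases and the trace *)

Section parseval.
Context {R : realType} {H : hilbertType R}.
Implicit Types (x y z e f : H) (F G K : seq H) (E : set H).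

Definition sqmod (a : R[i]) : R := complex.Re a ^+ 2 + complex.Im a ^+ 2.

Lemma sqmod_ge0 a : 0 <= sqmod a.
Proof. by rewrite addr_ge0// sqr_ge0. Qed.

Lemma sqmod_eq0 a : sqmod a = 0 -> a = 0.
Proof.
case: a => a b /eqP; rewrite /sqmod/= paddr_eq0 ?sqr_ge0// !sqrf_eq0.
by move=> /andP[/eqP -> /eqP ->].
Qed.

Lemma sqmod_dotpC x y : sqmod (dotp x y) = sqmod (dotp y x).
Proof. by rewrite dotpC; case: dotp => a b; rewrite /sqmod/= sqrrN. Qed.

Lemma sqmod_dotpE x y : sqmod (dotp x y) = ip x y ^+ 2 + ip x ('i *: y) ^+ 2.
Proof. by rewrite dotpE. Qed.

Lemma ip_dotpZ x y : ip x (dotp x y *: y) = sqmod (dotp x y).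
Proof.
by rewrite /ip dotpZr; case: dotp => a b; rewrite /sqmod/= mulNr opprK !expr2.
Qed.

Lemma hnormZ_sqr (a : R[i]) e : dotp e e = 1 -> hnorm (a *: e) ^+ 2 = sqmod a.
Proof.
move=> e1; rewrite -ipxx /ip dotpZl dotpZr e1 mulr1; case: a => a b.
by rewrite /sqmod/= mulrN opprK !expr2.
Qed.

Definition orthonormal E := (forall e, E e -> dotp e e = 1) /\
  forall e f, E e -> E f -> e <> f -> dotp e f = 0.

Definition span_proj F x : H := \sum_(e <- F) dotp x e *: e.

Section bessel.
Variables (E : set H) (onE : orthonormal E) (x : H).

Lemma dotp_span_proj F e : uniq F -> [set` F] `<=` E -> E e ->
  dotp (span_proj F x) e = if e \in F then dotp x e else 0.
Proof.
move=> uF FE Ee; elim: F uF FE => [_ _|f F IH /= /andP[fF uF] FE].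
  by rewrite /span_proj big_nil dotp0l.
have Ef : E f by apply: FE; rewrite /= mem_head.
have {}IH := IH uF (subset_trans (@mem_behead _ (f :: F)) FE).
rewrite /span_proj big_cons dotpDl dotpZl -/(span_proj F x) IH inE.
have [->|ef] := eqVneq e f; first by rewrite onE.1// mulr1 (negPf fF) addr0.
by rewrite (onE.2 f e) ?mulr0 ?add0r// => fe; rewrite fe eqxx in ef.
Qed.

Lemma dotp_sub_span_proj F e : uniq F -> [set` F] `<=` E -> E e ->
  dotp (x - span_proj F x) e = if e \in F then 0 else dotp x e.
Proof.
move=> uF FE Ee; rewrite dotpBl dotp_span_proj//.
by case: ifPn => _; rewrite ?subrr ?subr0.
Qed.

Lemma hnorm_sub_span_proj F : uniq F -> [set` F] `<=` E ->
  hnorm (x - span_proj F x) ^+ 2 = hnorm x ^+ 2 - \sum_(e <- F) sqmod (dotp x e).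
Proof.
elim: F => [_ _|f F IH /= /andP[fF uF] FE].
  by rewrite /span_proj !big_nil !subr0.
have Ef : E f by apply: FE; rewrite /= mem_head.
have F'E := subset_trans (@mem_behead _ (f :: F)) FE.
have {}IH := IH uF F'E.
rewrite /span_proj !big_cons -/(span_proj F x).
rewrite [_ *: f + _]addrC opprD addrA hnormB_sqr IH hnormZ_sqr ?onE.1//.
have -> : dotp x f = dotp (x - span_proj F x) f.
  by rewrite dotp_sub_span_proj// (negPf fF).
by rewrite ip_dotpZ; ring.
Qed.

Lemma bessel F : uniq F -> [set` F] `<=` E ->
  \sum_(e <- F) sqmod (dotp x e) <= hnorm x ^+ 2.
Proof. by move=> uF FE; rewrite -subr_ge0 -hnorm_sub_span_proj// sqr_ge0. Qed.

Lemma hnorm_span_proj F : uniq F -> [set` F] `<=` E ->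
  hnorm (span_proj F x) ^+ 2 = \sum_(e <- F) sqmod (dotp x e).
Proof.
move=> uF FE; have := hnorm_sub_span_proj uF FE; rewrite hnormB_sqr.
have -> : ip x (span_proj F x) = \sum_(e <- F) sqmod (dotp x e).
  rewrite /span_proj; elim: F {uF FE} => [|f F IH]; first by rewrite !big_nil ip0r.
  by rewrite !big_cons ipDr IH ip_dotpZ.
by move=> /eqP; lra.
Qed.

Lemma perm_subseq_cat F G : uniq F -> uniq G -> {subset F <= G} ->
  perm_eq G ([seq g <- G | g \notin F] ++ F).
Proof.
move=> uF uG FG; apply: uniq_perm => //.
  rewrite cat_uniq filter_uniq// uF andbT/=; apply/hasPn => g gF.
  by rewrite mem_filter gF.
move=> g; rewrite mem_cat mem_filter.
by have [/FG ->|] := boolP (g \in F); rewrite ?orbT ?orbF.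
Qed.

Lemma hnorm_span_projB F G : uniq F -> uniq G -> {subset F <= G} ->
  [set` G] `<=` E -> hnorm (span_proj F x - span_proj G x) ^+ 2 =
  \sum_(e <- G) sqmod (dotp x e) - \sum_(e <- F) sqmod (dotp x e).
Proof.
move=> uF uG FG GE; have pG := perm_subseq_cat uF uG FG.
rewrite /span_proj !(perm_big _ pG)/= !big_cat/= addrK opprD addrCA subrr addr0.
rewrite hnorm_opp hnorm_span_proj//; first exact: filter_uniq.
by move=> g /=; rewrite mem_filter => /andP[_ /GE].
Qed.

End bessel.

(** [E] may be uncountable, so an increasing sequence of finite subsets nearly attaining the
    supremum of the finite sums is used. The projections of [x] onto their spans are Cauchy, and [x]
    minus their limit is orthogonal to all of [E], hence zero. *)
Lemma parseval_le E x s : orthonormal_basis E ->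
  (forall F, uniq F -> [set` F] `<=` E -> \sum_(e <- F) sqmod (dotp x e) <= s) ->
  hnorm x ^+ 2 <= s.
Proof.
move=> [E1 E0 Ec]; have onE : orthonormal E by [].
pose W := [set F | uniq F /\ [set` F] `<=` E].
pose S := (fun F => \sum_(e <- F) sqmod (dotp x e)) @` W.
have W0 : W [::] by split.
have S0 : S !=set0 by exists (\sum_(e <- [::]) sqmod (dotp x e)), [::].
move=> Ss; apply: (@le_trans _ _ (sup S)); last first.
  by apply: ge_sup => // _ [F [uF FE] <-]; exact: Ss.
have {Ss} supS : has_sup S by split=> //; exists s => _ [F [uF FE] <-]; exact: Ss.
have /choice[A HA] (n : nat) : exists F, W F /\ sup S - n.+1%:R^-1 < \sum_(e <- F) sqmod (dotp x e).
  have [|_ [F WF <-] SF] := @sup_adherent _ S n.+1%:R^-1 _ supS; first by rewrite invr_gt0.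
  by exists F.
pose G := fix G n := if n is k.+1 then undup (A k ++ G k) else [::].
have GW n : W (G n).
  elim: n => [|n [uG GE]] //=; split; first exact: undup_uniq.
  move=> e /=; rewrite mem_undup mem_cat => /orP[|/GE//].
  by have [[_ AE] _] := HA n; exact: AE.
have Gnd n k : (n <= k)%N -> {subset G n <= G k}.
  move=> /subnK <-; elim: (k - n)%N => // j IH e /IH.
  by rewrite addSn /= mem_undup mem_cat => ->; rewrite orbT.
have sub_le F F' : uniq F -> uniq F' -> {subset F <= F'} ->
    \sum_(e <- F) sqmod (dotp x e) <= \sum_(e <- F') sqmod (dotp x e).
  move=> uF uF' FF'; rewrite (perm_big _ (perm_subseq_cat uF uF' FF'))/= big_cat/=.
  by rewrite lerDr sumr_ge0// => e _; exact: sqmod_ge0.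
have GS n : sup S - n.+1%:R^-1 < \sum_(e <- G n.+1) sqmod (dotp x e).
  have [[uA AE] /lt_le_trans] := HA n; apply; apply: sub_le => //; first by exact: (GW n.+1).1.
  by move=> e eA /=; rewrite mem_undup mem_cat eA.
have SG F : W F -> \sum_(e <- F) sqmod (dotp x e) <= sup S.
  by move=> WF; apply: sup_upper_bound => //; exists F.
pose u n := span_proj (G n.+1) x.
have gap (a b t i d : R) : a <= t -> t - i < b -> i < d -> a - b < d by lra.
have small (e : R) : 0 < e -> exists N, forall n, (N <= n)%N -> n.+1%:R^-1 < e.
  move=> e0; have := @near_infty_natSinv_lt R (PosNum e0) => -[N _ HN].
  by exists N => n Nn; exact: HN.
have [y uy] : exists y : H, u n @[n --> \oo] --> y.
  apply: cauchy_hnorm_cvg => e e0.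
  have [N HN] := small _ (exprn_gt0 2 e0).
  exists N => n k Nn nk; rewrite -(@ltr_pXn2r _ 2)// ?nnegrE ?hnorm_ge0// ?ltW//.
  rewrite (hnorm_span_projB onE x (GW n.+1).1 (GW k.+1).1 _ (GW k.+1).2); last exact: Gnd.
  exact: gap (SG _ (GW k.+1)) (GS n) (HN _ Nn).
have xy0 : x - y = 0.
  apply: Ec => e Ee; apply: sqmod_eq0; rewrite sqmod_dotpE.
  have xuy : x - u n @[n --> \oo] --> x - y by apply: cvgB => //; exact: cvg_cst.
  have c1 := cvg_ip (y := e) xuy; have c2 := cvg_ip (y := 'i *: e) xuy.
  have c3 : sqmod (dotp (x - u n) e) @[n --> \oo] --> ip (x - y) e ^+ 2 + ip (x - y) ('i *: e) ^+ 2.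
    rewrite (_ : (fun n => _) = fun n => ip (x - u n) e ^+ 2 + ip (x - u n) ('i *: e) ^+ 2).
      by rewrite !expr2; under eq_fun do rewrite !expr2; apply: cvgD; exact: cvgM.
    by apply/funext => n; rewrite sqmod_dotpE.
  apply: (cvg_unique _ c3) => //.
  apply/cvgrPdist_lt => d d0; have [N HN] := small _ d0.
  exists N => // n /= Nn; rewrite sub0r normrN ger0_norm ?sqmod_ge0//.
  have [uG GE] := GW n.+1.
  (* If [e] lies outside [G n.+1], adding it cannot push the sum beyond [sup S], so its coefficient
     is below the remaining gap. *)
  rewrite (dotp_sub_span_proj onE)//; case: ifPn => eG; first by rewrite /sqmod/= !expr0n/= addr0.
  have := SG (e :: G n.+1); rewrite big_cons => SG1.
  have h : sqmod (dotp x e) + \sum_(j <- G n.+1) sqmod (dotp x j) <= sup S.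
    by apply: SG1; split=> [|f /=]; [rewrite /= eG|rewrite inE => /predU1P[->|/GE]].
  rewrite -[ltLHS](addrK (\sum_(j <- G n.+1) sqmod (dotp x j))).
  exact: gap h (GS n) (HN _ Nn).
have {}uy : hnorm (x - u n) ^+ 2 @[n --> \oo] --> (0 : R).
  have /cvg_hnorm := uy; move/eqP : xy0; rewrite subr_eq0 => /eqP <- h.
  rewrite (_ : (fun n => _) = fun n => hnorm (u n - x) * hnorm (u n - x)).
    by rewrite -[X in _ --> X](mulr0 0); exact: cvgM.
  by apply/funext => n; rewrite -hnorm_opp opprB expr2.
rewrite -subr_le0; apply: (cvgr_to_ge uy); apply: nearW => n.
by rewrite (hnorm_sub_span_proj onE x (GW n.+1).1 (GW n.+1).2) lerB// SG.
Qed.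

Lemma parseval E x : orthonormal_basis E ->
  (\esum_(e in E) (sqmod (dotp x e))%:E = (hnorm x ^+ 2)%:E)%E.
Proof.
move=> bE; have onE : orthonormal E by case: bE.
have fsE (A : set H) : finite_set A ->
    (\sum_(e \in A) (sqmod (dotp x e))%:E)%E =
    (\sum_(e <- finmap.enum_fset (fset_set A)) sqmod (dotp x e))%:E.
  by move=> fA; rewrite fsbig_finite//= sumEFin.
have le1 : (\esum_(e in E) (sqmod (dotp x e))%:E <= (hnorm x ^+ 2)%:E)%E.
  apply: ge_ereal_sup => _ [A [fA AE] <-]; rewrite fsE// lee_fin.
  apply: (bessel onE) => [|e /=]; first exact: finmap.fset_uniq.
  by rewrite in_fset_set// inE => /AE.
apply/eqP; rewrite eq_le le1/=.
have ge0 : (0 <= \esum_(e in E) (sqmod (dotp x e))%:E)%E.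
  by apply: esum_ge0 => e _; rewrite lee_fin sqmod_ge0.
have fin : \esum_(e in E) (sqmod (dotp x e))%:E \is a fin_num.
  by rewrite ge0_fin_numE// (le_lt_trans le1) ?ltry.
rewrite -(fineK fin) lee_fin; apply: (parseval_le bE) => F uF FE.
rewrite -lee_fin fineK//; apply: esum_ge; exists [set` F].
  by split => //; exact: finite_seq.
by rewrite -fsbig_seq// sumEFin.
Qed.

(** Zorn's lemma excludes the default of [xget]: a nonzero vector orthogonal to a maximal
    orthonormal family could be normalized and added to it. *)
Lemma onbP : orthonormal_basis (@onb R H).
Proof.
rewrite /onb; case: xgetP => [E _ //|noE].
pose T := {E : set H | orthonormal E}.
have on0 : orthonormal set0 by split.
have [||||[E onE] Emax] := @Zorn T (fun s t => `[< sval s `<=` sval t >]).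
- by move=> s; apply/asboolP.
- by move=> r s t /asboolP rs /asboolP st; apply/asboolP; exact: subset_trans st.
- move=> [s hs] [t ht] /asboolP/= st /asboolP/= ts.
  by apply: eq_exist; apply/seteqP.
- move=> A Atot.
  have onU : orthonormal (\bigcup_(s in A) sval s).
    split=> [e [s As se]|e f [s As se] [t At tf]]; first exact: (svalP s).1.
    have [/asboolP st|/asboolP ts] := Atot _ _ As At.
      by apply: (svalP t).2 => //; exact: st.
    by apply: (svalP s).2 => //; exact: ts.
  by exists (exist _ _ onU) => s As; apply/asboolP => /= e se; exists s.
exfalso; apply: (noE E); split; [exact: onE.1|exact: onE.2|].
move=> x xE; apply: contrapT => /eqP x0.
have hx : 0 < hnorm x by rewrite lt_def hnorm_ge0 hnorm_eq0 x0.
pose e := ((hnorm x)^-1)%:C *: x.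
have ee : dotp e e = 1.
  rewrite dotpp hnormZ ger0_norm ?invr_ge0 ?hnorm_ge0// mulVf ?gt_eqF//.
  by rewrite expr1n.
have eE f : E f -> dotp e f = 0 by move=> Ef; rewrite dotpZl xE// mulr0.
have onEe : orthonormal (E `|` [set e]).
  split=> [f [/onE.1//|->//]|f g [Ef|->] [Eg|->]//].
  - exact: onE.2.
  - by move=> _; rewrite dotpC eE// rmorph0.
  - by move=> _; exact: eE.
have := Emax (exist _ _ onEe) => /(_ _)/(congr1 sval)/= EeE.
have Ee : E e by rewrite -EeE; [right|apply/asboolP => /= f; left].
by have := eE _ Ee; rewrite ee => /eqP; rewrite oner_eq0.
Qed.

End parseval.

Section trace.
Context {R : realType} {H : hilbertType R}.
Implicit Types (A B D J : H -> H) (x y z e f : H).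

Lemma le_trace_pos A B : (forall x, ip (A x) x <= ip (B x) x) ->
  (trace_pos A <= trace_pos B)%E.
Proof. by move=> AB; apply: le_esum => e _; rewrite lee_fin; exact: AB. Qed.

Lemma trace_pos_ge0 A : (forall x, 0 <= ip (A x) x) -> (0 <= trace_pos A)%E.
Proof. by move=> A0; apply: esum_ge0 => e _; rewrite lee_fin; exact: A0. Qed.

Lemma trace_posD A B : (forall x, 0 <= ip (A x) x) -> (forall x, 0 <= ip (B x) x) ->
  (trace_pos (A \+ B)%R = trace_pos A + trace_pos B)%E.
Proof.
move=> A0 B0; rewrite /trace_pos -esumD; [|by move=> e _; rewrite lee_fin; exact: A0
  |by move=> e _; rewrite lee_fin; exact: B0].
by apply: eq_esum => e _; rewrite -EFinD -[in LHS]/(ip _ _) ipDl.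
Qed.

(** With Q the square root of [B], Parseval expands the left side into the double sum of |<Q J e,
    f>|^2 = |<J Q f, e>|^2. Exchanging the sums leaves |J Q f|^2 = |Q f|^2. *)
Lemma trace_pos_conj B J : positive_op B -> bsym J -> (forall x, J (J x) = x) ->
  trace_pos (J \o B \o J) = trace_pos B.
Proof.
move=> pB sJ JJ; have [pQ QQ _] := sqrt_opP pB; set Q := sqrt_op B in pQ QQ.
have /positive_opP[sQ _] := pQ.
transitivity (\esum_(e in onb) \esum_(f in onb) (sqmod (dotp (Q (J e)) f))%:E).
  apply: eq_esum => e _; rewrite (parseval _ onbP) -[in LHS]/(ip _ _) /=.
  by rewrite sJ.2 -QQ ip_sqr.
transitivity (\esum_(f in onb) \esum_(e in onb) (sqmod (dotp (J (Q f)) e))%:E).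
  rewrite !esum_esum; [|by move=> e f _ _; rewrite lee_fin sqmod_ge0..].
  rewrite (reindex_esum (onb `*`` (fun=> onb)) (onb `*`` (fun=> onb)) (fun p => (p.2, p.1))).
    apply: eq_esum => -[e f] _ /=; congr (_ %:E).
    by rewrite sqmod_dotpC (bsym_dotp sJ) (bsym_dotp sQ).
  split=> [[e f] []//|[e f] [e' f'] _ _ [-> ->]//|[e f] [/= oe of_]].
  by exists (f, e).
apply: eq_esum => f _; rewrite (parseval _ onbP) -[in RHS]/(ip _ _).
by congr (_ %:E); rewrite -ipxx -sJ.2 JJ -QQ ip_sqr// ipxx.
Qed.

(** The pointwise bound 2 |D| <= B + J B J is summed over the basis, and both terms on the right
    have the same trace. *)
Lemma trace_abs_le D B : bsym D -> positive_op B ->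
  (forall x, `|ip (D x) x| <= ip (B x) x) ->
  (trace_pos (abs_op D) <= trace_pos B)%E.
Proof.
move=> sD pB DB; have [J [sJ JJ NJ JN]] := polar_symmetry sD.
have [pN _ _] := abs_opP sD; have /positive_opP[_ N0] := pN.
have /positive_opP[_ B0] := pB.
have BJ0 x : 0 <= ip ((J \o B \o J) x) x by rewrite /= sJ.2.
have : (trace_pos (abs_op D \+ abs_op D)%R <= trace_pos (B \+ (J \o B \o J))%R)%E.
  apply: le_trace_pos => x /=; rewrite !ipDl sJ.2.
  by have := abs_op_le sD pB.1.1 sJ JN JJ DB x; lra.
rewrite !trace_posD// trace_pos_conj//.
have := trace_pos_ge0 N0; have := trace_pos_ge0 B0.
case: (trace_pos (abs_op D)) (trace_pos B) => [a| |] [b| |]//=.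
  by rewrite -!EFinD !lee_fin; lra.
by move=> _ _ _; rewrite leey.
Qed.

End trace.

(** * The trace distance as a metric on S_1(H)_+ *)

Section trace_distance.
Context {R : realType} {H : hilbertType R}.
Local Notation S1 := (pos_trace_class H).
Implicit Types (S T U : S1).

Lemma S1_bsym S : bsym S.
Proof. by have /positive_opP[] := pos_trace_class_positive S. Qed.

Lemma S1_ge0 S x : 0 <= ip (S x) x.
Proof. by have /positive_opP[] := pos_trace_class_positive S. Qed.

Lemma S1_trace_lty S : (trace_pos S < +oo)%E.
Proof.
have [_] := pos_trace_class_trace S.
by rewrite abs_op_positive//; exact: pos_trace_class_positive.
Qed.

Lemma S1_exists (A : H -> H) : positive_op A -> (trace_pos A < +oo)%E ->
  exists S : S1, S = A :> (H -> H).
Proof.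
move=> pA tA; have tcA : trace_class A by split; [exact: pA.1|rewrite abs_op_positive].
by exists (PosTraceClass pA tcA).
Qed.

Lemma S1_ext S T : S = T :> (H -> H) -> S = T.
Proof.
case: S T => [A pA tA] [B pB tB] /= AB; subst B.
by rewrite (Prop_irrelevance pA pB) (Prop_irrelevance tA tB).
Qed.

Definition trace_dist S T : R := trace_norm (S \- T).

(** The form of S - T is dominated by that of S + T, whose trace is finite, so [fine] in [tr] loses
    nothing. *)
Lemma trace_distE S T : (trace_dist S T)%:E = trace_pos (abs_op (S \- T)).
Proof.
rewrite /trace_dist /trace_norm /tr fineK//.
have sD := bsymB (S1_bsym S) (S1_bsym T).
have [/positive_opP[_ pN] _ _] := abs_opP sD.
rewrite ge0_fin_numE; last exact: trace_pos_ge0.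
have pST : positive_op (S \+ T).
  apply/positive_opP; split; first exact: bsymD (S1_bsym _) (S1_bsym _).
  by move=> x; rewrite ipDl addr_ge0 ?S1_ge0.
apply: le_lt_trans (trace_abs_le sD pST _) _.
  move=> x; rewrite ipBl ipDl (le_trans (ler_normB _ _))//.
  by rewrite !ger0_norm ?S1_ge0.
by rewrite trace_posD ?lte_add_pinfty// ?S1_trace_lty//; exact: S1_ge0.
Qed.

Lemma trace_dist_ge0 S T : 0 <= trace_dist S T.
Proof.
have [/positive_opP[_ pN] _ _] := abs_opP (bsymB (S1_bsym S) (S1_bsym T)).
by rewrite -lee_fin trace_distE trace_pos_ge0.
Qed.

Lemma trace_distC S T : trace_dist S T = trace_dist T S.
Proof. by rewrite /trace_dist /trace_norm abs_opB//; exact: S1_bsym. Qed.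

(** The operator |S - T| + |T - U| dominates S - U in the sense required by [trace_abs_le]. *)
Lemma trace_dist_triangle S T U : trace_dist S U <= trace_dist S T + trace_dist T U.
Proof.
rewrite -lee_fin EFinD !trace_distE.
have sST := bsymB (S1_bsym S) (S1_bsym T).
have sTU := bsymB (S1_bsym T) (S1_bsym U).
have [/positive_opP[sN pN] _ _] := abs_opP sST.
have [/positive_opP[sM pM] _ _] := abs_opP sTU.
rewrite -trace_posD//; apply: trace_abs_le.
- by apply: bsymB; exact: S1_bsym.
- apply/positive_opP; split; first exact: bsymD.
  by move=> x; rewrite ipDl addr_ge0.
- move=> x; rewrite [in leRHS]/= ipDl.
  have -> : (S \- U) x = (S \- T) x + (T \- U) x by rewrite /= addrA subrK.
  rewrite ipDl (le_trans (ler_normD _ _))// lerD//; exact: abs_op_ge.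
Qed.

Lemma trace_dist_eq0 S T : trace_dist S T = 0 -> S = T.
Proof.
move=> ST0; apply: S1_ext; apply/funext => x.
have sD := bsymB (S1_bsym S) (S1_bsym T).
have [pN NN _] := abs_opP sD; have /positive_opP[sN N0] := pN.
set N := abs_op _ in pN NN sN N0.
have trN : trace_pos N = 0%E by rewrite -trace_distE ST0.
have Ne e : onb e -> N e = 0.
  move=> oe; apply: psd_eq0 => //; apply/eqP; rewrite eq_le N0 andbT.
  rewrite -lee_fin -[leRHS]trN; apply: esum_ge; exists [set e].
    by split=> [|_ ->//]; exact: finite_set1.
  by rewrite fsbig_set1.
have Nx : N x = 0.
  have [_ _ oc] := @onbP R H; apply: oc => e oe.
  by rewrite (bsym_dotp sN) Ne// dotp0r.
apply/eqP; rewrite -subr_eq0 -hnorm_eq0 -sqrf_eq0 -[S x - T x]/((S \- T) x).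
by rewrite -ip_sqr// -NN Nx linear0op ?ip0l//; exact: sN.1.1.
Qed.

(** A finite part [F] of the basis carries tr (A_0 - T) up to e / 2. Since tr (A_0 - T) = tr (A_n -
    T) + tr (A_0 - A_n), what A_n - T retains outside [F] stays below e / 2, while its finitely many
    diagonal entries on [F] tend to 0. *)
Lemma decreasing_cvg_trace_dist (A : nat -> S1) T :
  (forall n x, ip (A n.+1 x) x <= ip (A n x) x) ->
  (forall n x, ip (T x) x <= ip (A n x) x) ->
  (forall x, A n x @[n --> \oo] --> T x) ->
  forall e, 0 < e -> exists N, forall n, (N <= n)%N -> trace_dist (A n) T < e.
Proof.
move=> dA TA AT e e0; have e2 : 0 < e / 2 by rewrite divr_gt0.
have pD n : positive_op (A n \- T).
  apply/positive_opP; split; first by apply: bsymB; exact: S1_bsym.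
  by move=> x; rewrite ipBl subr_ge0.
have dE n : (trace_dist (A n) T)%:E = trace_pos (A n \- T).
  by rewrite trace_distE abs_op_positive.
have dA' n x : ip (A n x) x <= ip (A 0%N x) x.
  by elim: n => // n IH; exact: le_trans (dA _ _) IH.
pose q n x := ip ((A n \- T) x) x.
have [F uF [Fonb FE]] : exists2 F : seq H, uniq F & [set` F] `<=` onb /\
    trace_dist (A 0%N) T - e / 2 < \sum_(x <- F) q 0%N x.
  have : ((trace_dist (A 0%N) T - e / 2)%:E < trace_pos (A 0%N \- T)%R)%E.
    by rewrite -dE lte_fin gtrBl.
  move=> /ereal_sup_gt[_ [X [finX Xonb] <-]].
  rewrite fsbig_finite//= sumEFin lte_fin => qX.
  exists (finmap.enum_fset (fset_set X)); [exact: finmap.fset_uniq|split=> // x /=].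
  by rewrite in_fset_set// inE => /Xonb.
have cvgq : \sum_(x <- F) q n x @[n --> \oo] --> (0 : R).
  elim: (F) => [|x F' IH].
    rewrite (_ : (fun n => _) = cst 0); first exact: cvg_cst.
    by apply/funext => n; rewrite big_nil.
  rewrite (_ : (fun n => _) = fun n => q n x + \sum_(y <- F') q n y); last first.
    by apply/funext => n; rewrite big_cons.
  rewrite -[X in _ --> X](addr0 0).
  apply: cvgD => //; rewrite -[X in _ --> X](subrr (ip (T x) x)).
  rewrite (_ : q^~ x = fun n => ip (A n x) x - ip (T x) x).
    by apply: cvgB; [apply: cvg_ip; exact: AT|exact: cvg_cst].
  by apply/funext => n; rewrite /q ipBl.
have /cvgrPdist_lt/(_ _ e2)[N _ HN] := cvgq.
exists N => n /HN; rewrite sub0r normrN => /(le_lt_trans (ler_norm _)) qn.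
have A0n0 x : 0 <= ip ((A 0%N \- A n) x) x by rewrite ipBl subr_ge0.
have split0 : (trace_dist (A 0%N) T)%:E = ((trace_dist (A n) T)%:E + trace_pos (A 0%N \- A n)%R)%E.
  rewrite !dE -trace_posD// => [|x]; last by have /positive_opP[] := pD n.
  by congr trace_pos; apply/funext => x /=; hvec.
have : ((\sum_(x <- F) (q 0%N x - q n x))%:E <= trace_pos (A 0%N \- A n)%R)%E.
  apply: esum_ge; exists [set` F]; first by split => //; exact: finite_seq.
  rewrite -fsbig_seq// sumEFin lee_fin le_eqVlt; apply/orP; left; apply/eqP.
  by apply: eq_bigr => x _; rewrite /q -/(ip _ _) !ipBl; ring.
have trfin : trace_pos (A 0%N \- A n)%R \is a fin_num.
  rewrite ge0_fin_numE; last exact: trace_pos_ge0.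
  rewrite (le_lt_trans _ (S1_trace_lty (A 0%N)))// le_trace_pos// => x.
  by rewrite ipBl gerBl S1_ge0.
move: split0; rewrite -(fineK trfin) -EFinD lee_fin sumrB => -[].
move: (fine _) qn FE => t; move: (\sum_(x <- F) q 0%N x) (\sum_(x <- F) q n x) => a b.
by lra.
Qed.

End trace_distance.

(** * The residual tree *)

Section residual_tree.
Context {R : realType} {H : hilbertType R} {m : nat}.
Variables (R0 : pos_trace_class H) (C : 'I_m -> H -> H).
Hypothesis hC : forall j : 'I_m, contraction_op (C j).
Local Notation S1 := (pos_trace_class H).

(* In the second case, where adjoint has its junk value 0, a residual step
   leaves its argument unchanged, so existence of adjoints is never needed. *)
Lemma adjoint_cases (A : H -> H) : (bounded_op (adjoint A) /\
  forall x y, dotp (A x) y = dotp x (adjoint A y)) \/ adjoint A = \0.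
Proof. by rewrite /adjoint; case: xgetP => [B _ hB|_]; [left|right]. Qed.

(** With q the square root of [Q] and K = C* C, the new form at x is <(I - K) q x, q x>, and
    contractivity of [C j] gives 0 <= K <= I. *)
Lemma residual_step_positive (Q : H -> H) j : positive_op Q ->
  positive_op (residual_step C Q j) /\
  forall x, ip (residual_step C Q j x) x <= ip (Q x) x.
Proof.
move=> pQ; have [pq qq _] := sqrt_opP pQ; set q := sqrt_op Q in pq qq.
have /positive_opP[[bq sq] _] := pq.
have [bC cC] := hC j.
have {}cC x : hnorm (C j x) <= hnorm x by have := cC x; rewrite !hnormE lecR.
pose K := adjoint (C j) \o C j.
have [sK K0 K1] : [/\ bsym K, forall x, 0 <= ip (K x) x &
    forall x, ip (K x) x <= hnorm x ^+ 2].
  have [[bA AC]|A0] := adjoint_cases (C j); last first.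
    rewrite /K A0; split=> [|x|x]; rewrite /= ?ip0l ?sqr_ge0//.
    by have /positive_opP[] := @positive_op0 R H.
  have KE x y : ip (K x) y = ip (C j x) (C j y) by rewrite ipC [LHS]/ip -AC -/(ip _ _) ipC.
  split=> [|x|x]; rewrite ?KE ?ipxx ?sqr_ge0//.
    by split=> [|x y]; [exact: bounded_op_comp|rewrite KE ipC [RHS]ipC KE].
  by rewrite ler_pXn2r ?nnegrE ?hnorm_ge0.
have rE x y : ip (residual_step C Q j x) y = ip ((idfun \- K) (q x)) (q y).
  by rewrite /residual_step -/q /= sq.
have sI : bsym (idfun \- K) by apply: bsymB => //; exact: bsym_id.
split=> [|x]; last first.
  rewrite rE ipBl -[in leRHS]qq [in leRHS]sq gerBl; exact: K0.
apply/positive_opP; split; last by move=> x; rewrite rE ipBl ipxx subr_ge0.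
split; first by apply: bounded_op_comp => //; apply: bounded_op_comp => //; exact: sI.1.
by move=> x y; rewrite rE ipC [RHS]ipC rE ipC sI.2 ipC.
Qed.

Lemma residual_rcons w j :
  residual R0 C (rcons w j) = residual_step C (residual R0 C w) j.
Proof. by rewrite /residual -cats1 foldl_cat. Qed.

Lemma residual_positive w : positive_op (residual R0 C w) /\
  forall x, ip (residual R0 C w x) x <= ip (R0 x) x.
Proof.
elim/last_ind: w => [|w j [pw lew]].
  by split; first exact: pos_trace_class_positive.
have [ps les] := residual_step_positive j pw; rewrite residual_rcons.
by split=> // x; exact: le_trans (les x) (lew x).
Qed.

Lemma residual_S1 (u : seq (alphabet m)) : exists S : S1, S = residual0 R0 C u :> (H -> H).
Proof.
have [pu leu] := residual_positive (live_prefix u).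
apply: S1_exists => //; apply: le_lt_trans (S1_trace_lty R0).
exact: le_trace_pos.
Qed.

Lemma live_prefix_rcons (u : seq (alphabet m)) a :
  live_prefix (rcons u a) = live_prefix u \/
  exists j, live_prefix (rcons u a) = rcons (live_prefix u) j.
Proof.
have lz j : (lift ord0 j == ord0 :> 'I_m.+1) = false.
  by apply/negP => /eqP /(congr1 val).
elim: u => [|b u IH]; rewrite /live_prefix /=.
  case: (unliftP ord0 a) => [j ->|->]; last by rewrite eqxx; left.
  by right; exists j; rewrite lz /= liftK.
case: (unliftP ord0 b) => [j ->|->]; last by rewrite eqxx; left.
rewrite lz /= liftK /=; move: IH; rewrite /live_prefix => -[->|[k ->]]; first by left.
by right; exists k.
Qed.

Lemma path_prefixS (omega : path_space m) n :
  path_prefix omega n.+1 = rcons (path_prefix omega n) (omega n).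
Proof. exact: mkseqS. Qed.

Lemma residual0_decreasing (omega : path_space m) n x :
  ip (residual0 R0 C (path_prefix omega n.+1) x) x <=
  ip (residual0 R0 C (path_prefix omega n) x) x.
Proof.
rewrite path_prefixS /residual0.
case: (live_prefix_rcons (path_prefix omega n) (omega n)) => [->//|[j ->]].
rewrite residual_rcons.
by have [] := residual_step_positive j (residual_positive (live_prefix (path_prefix omega n))).1.
Qed.

(** All that the measure theory uses of the operators: R_infty is a pointwise trace-norm limit of
    functions of finite prefixes. The points [rs u] form a countable family. *)
Lemma residual_lim_cvg : exists rs : seq (alphabet m) -> S1,
  forall (omega : path_space m) (e : R), 0 < e -> exists N, forall n, (N <= n)%N ->
    trace_dist (rs (path_prefix omega n)) (residual_lim R0 C omega) < e.
Proof.
have [rs rsE] := choice residual_S1; exists rs => omega.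
have [T [pT cT leT]] := decreasing_positive_cvg
  (fun n => (residual_positive (live_prefix (path_prefix omega n))).1)
  (residual0_decreasing omega).
have leT0 := leT 0%N.
have [S ST] : exists S : S1, S = T :> (H -> H).
  apply: S1_exists => //; apply: le_lt_trans (S1_trace_lty R0).
  exact: le_trace_pos.
have cL : forall x, residual0 R0 C (path_prefix omega n) x @[n --> \oo] -->
    residual_lim R0 C omega x.
  rewrite /residual_lim; case: xgetP => [U _ //|/(_ S)]; case=> x.
  by rewrite ST; exact: cT.
have LT x : residual_lim R0 C omega x = T x.
  exact: (cvg_unique _ (cL x) (cT x)).
apply: decreasing_cvg_trace_dist => [n x|n x|x]; rewrite ?rsE ?LT //.
- exact: residual0_decreasing.
- exact: leT.
have -> : (fun n => rs (path_prefix omega n) x) =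
    fun n => residual0 R0 C (path_prefix omega n) x.
  by apply/funext => n; rewrite rsE.
exact: cT.
Qed.

End residual_tree.

(** * Borel structure of the path space *)

Section path_space_borel.
Context {m : nat}.
Local Notation Omega := (path_space m).
Implicit Types (omega : Omega) (u v : seq (alphabet m)).

Lemma path_prefix_eq omega omega' n : path_prefix omega n = path_prefix omega' n <->
  forall i, (i < n)%N -> omega i = omega' i.
Proof.
split=> [oo' i ni|oo'].
  have := congr1 (fun s => nth ord0 s i) oo'.
  by rewrite !(nth_mkseq ord0 _ ni).
apply: (@eq_from_nth _ (ord0 : 'I_m.+1)); rewrite !size_mkseq// => i ni.
by rewrite !nth_mkseq// oo'.
Qed.

Lemma path_prefix_le omega omega' n k : (n <= k)%N ->
  path_prefix omega k = path_prefix omega' k -> path_prefix omega n = path_prefix omega' n.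
Proof.
by move=> nk /path_prefix_eq h; apply/path_prefix_eq => i ni; apply: h; exact: leq_trans nk.
Qed.

Lemma cylinderE omega n : cylinder (path_prefix omega n) =
  [set omega' | path_prefix omega' n = path_prefix omega n].
Proof. by rewrite /cylinder size_mkseq. Qed.

(** The sets containing a cylinder around [omega] form a filter; it converges to [omega] because
    each coordinate is eventually constant along it. *)
Lemma nbhs_cylinder omega (V : set Omega) : nbhs omega V ->
  exists n, cylinder (path_prefix omega n) `<=` V.
Proof.
pose F : set_system Omega := [set W | exists n, cylinder (path_prefix omega n) `<=` W].
have FF : Filter F.
  split; first by exists 0%N.
    move=> P Q [n nP] [k kQ]; exists (maxn n k); rewrite cylinderE => w /= h.
    split; [apply: nP|apply: kQ]; rewrite cylinderE /=.
      exact: path_prefix_le (leq_maxl _ _) h.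
    exact: path_prefix_le (leq_maxr _ _) h.
  by move=> P Q PQ [n nP]; exists n; exact: subset_trans PQ.
suff : F --> omega by apply.
apply/cvg_sup => i W.
rewrite nbhsE/= => -[U [[A oA <-] Aomega] UW].
exists i.+1; rewrite cylinderE => w /= /path_prefix_eq h; apply: UW.
by rewrite /= h.
Qed.

Lemma prefix_near omega n : nbhs omega [set omega' | path_prefix omega' n = path_prefix omega n].
Proof.
elim: n => [|n IH]; first exact: filterS filterT.
have on : nbhs omega [set omega' : Omega | omega' n = omega n].
  apply: (@open_nbhs_nbhs Omega); split=> //.
  suff : open ((fun w : Omega => w n) @^-1` [set omega n]) by [].
  apply: open_comp; first by move=> w _; exact: (@proj_continuous nat (fun=> alphabet m) n w).
  exact: discrete_open.
apply: filterS2 IH on => w /= h hn.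
by rewrite /path_prefix !mkseqS -!/(path_prefix _ _) h hn.
Qed.

Lemma open_prefix (P : set (seq (alphabet m))) n :
  open [set omega : Omega | P (path_prefix omega n)].
Proof.
rewrite openE => omega /= Po; rewrite /interior; apply: filterS (prefix_near omega n).
by move=> w /= ->.
Qed.

Lemma measurable_prefix (P : set (seq (alphabet m))) n :
  measurable ([set omega | P (path_prefix omega n)] : set (borel Omega)).
Proof. by apply: sub_sigma_algebra; exact: open_prefix. Qed.

Lemma measurable_cylinder u : measurable (cylinder u : set (borel Omega)).
Proof. exact: (measurable_prefix [set u]). Qed.

(** [set0] is included for closure under intersection: two cylinders are disjoint or nested. *)
Definition cylinders : set (set Omega) := [set A | A = set0 \/ exists u, A = cylinder u].

Lemma measurable_cylinders (A : set (borel Omega)) : cylinders A -> measurable A.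
Proof. by case=> [->|[u ->]]; [exact: measurable0|exact: measurable_cylinder]. Qed.

Lemma setI_closed_cylinders : setI_closed cylinders.
Proof.
move=> A B [->|[u ->]] [->|[v ->]]; rewrite ?set0I ?setI0; try by left.
have [w|/set0P/negP/negPn/eqP ->] := pselect (cylinder u `&` cylinder v !=set0); last by left.
wlog uv : u v w / (size u <= size v)%N.
  case/orP: (leq_total (size u) (size v)) => [|vu] h; first exact.
  by rewrite setIC; apply: h => //; rewrite setIC.
right; exists v; apply/seteqP; split=> [x []//|x vx]; split=> //.
case: w => y [uy vy]; rewrite /cylinder/= -[RHS]uy.
by apply: path_prefix_le uv _; rewrite vx vy.
Qed.

(** There are countably many words, so every open set is a countable union of cylinders. *)
Lemma borel_cylinders :
  (@measurable _ (borel Omega) : set (set Omega)) = <<s cylinders >>.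
Proof.
apply/seteqP; split; last first.
  apply: smallest_sub; first exact: sigma_algebra_measurable.
  exact: measurable_cylinders.
apply: smallest_sub; first exact: smallest_sigma_algebra.
move=> U oU.
have -> : U = \bigcup_(u in [set u | cylinder u `<=` U]) cylinder u.
  apply/seteqP; split=> [w Uw|w [u uU]]; last exact: uU.
  have [n nU] := nbhs_cylinder (open_nbhs_nbhs (conj oU Uw)).
  by exists (path_prefix w n) => //; rewrite cylinderE.
rewrite bigcup_mkcond.
apply: (@countable_bigcupT_measurable _ (g_sigma_algebraType cylinders) (seq 'I_m.+1)).
  exact: countableP.
move=> u; case: ifP => _; apply: sub_sigma_algebra; last by left.
by right; exists u.
Qed.

End path_space_borel.

(** * Measurability of the limit map and separation of its values *)

Section borel_limit.
Context {R : realType} {H : hilbertType R} {m : nat}.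
Local Notation S1 := (pos_trace_class H).
Local Notation Omega := (path_space m).
Variables (rs : seq (alphabet m) -> S1) (L : Omega -> S1).
Hypothesis rsL : forall (omega : Omega) (e : R), 0 < e -> exists N, forall n, (N <= n)%N ->
  trace_dist (rs (path_prefix omega n)) (L omega) < e.

Lemma exists_natSinv_lt (e : R) : 0 < e -> exists k, k.+1%:R^-1 < e.
Proof.
move=> e0; have := @near_infty_natSinv_lt R (PosNum e0) => -[N _ HN].
by exists N; exact: HN (leqnn N).
Qed.

Lemma open_trace_ball (S : S1) (e : R) : open [set T : S1 | trace_dist T S < e].
Proof.
rewrite open_pos_trace_classE => T /= TS.
exists (e - trace_dist T S) => [|U]; first by rewrite subr_gt0.
rewrite -/(trace_dist U T) ltrBrDr; apply: le_lt_trans.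
exact: trace_dist_triangle.
Qed.

(** The limit lies in an open [U] exactly when, for some k, the approximants eventually stay at
    depth 1/(k+1) inside [U]. Each such condition reads finitely many letters. *)
Lemma measurable_trace_limit :
  measurable_fun setT (L : borel Omega -> borel S1).
Proof.
apply: (@measurability _ _ (borel Omega) (borel S1) _ _ (@open S1)) => //
  _ [U oU <-]; rewrite setTI.
pose core k := [set S : S1 | forall T, trace_dist T S < k.+1%:R^-1 -> U T].
rewrite (_ : _ @^-1` _ = \bigcup_k \bigcup_N \bigcap_(n in [set n | (N <= n)%N])
    [set omega | core k (rs (path_prefix omega n))]).
  apply: bigcupT_measurable => k; apply: bigcupT_measurable => N.
  apply: bigcap_measurable => [|n _]; first by exists N => /=.
  exact: (measurable_prefix (rs @^-1` core k)).
apply/seteqP; split=> [w Uw|w [k _ [N _ wN]]].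
  move: oU; rewrite open_pos_trace_classE => /(_ _ Uw)[e e0 eU].
  have [k ke] := exists_natSinv_lt (divr_gt0 e0 (ltr0n _ 2)).
  have [N HN] := rsL w (divr_gt0 e0 (ltr0n _ 2)).
  exists k => //; exists N => // n /= /HN Hn T Tn; apply: eU.
  rewrite -/(trace_dist T (L w)) (splitr e).
  rewrite (le_lt_trans (trace_dist_triangle _ (rs (path_prefix w n)) _))//.
  by rewrite ltrD// (lt_trans Tn).
have k0 : 0 < k.+1%:R^-1 :> R by rewrite invr_gt0.
have [N' HN'] := rsL w k0.
by apply: (wN (maxn N N')); [exact: leq_maxl|rewrite trace_distC HN'// leq_maxr].
Qed.

(** [Z] consists of the points that the countable family [rs] approximates at every scale. A point
    [T] of [Z] is told apart from any [S] at distance d by a ball around some [rs u] that contains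
    [T] and has radius below d / 2. *)
Lemma trace_limit_separating : exists (Z : set S1) (B : nat -> set S1),
  [/\ measurable (Z : set (borel S1)), forall n, measurable (B n : set (borel S1)),
    forall omega, Z (L omega) &
    forall S T, Z T -> (forall n, B n S <-> B n T) -> S = T].
Proof.
have mball (S : S1) (e : R) : measurable ([set T : S1 | trace_dist T S < e] : set (borel S1)).
  by apply: sub_sigma_algebra; exact: open_trace_ball.
pose ball (p : seq 'I_m.+1 * nat) := [set T : S1 | trace_dist T (rs p.1) < p.2.+1%:R^-1].
exists (\bigcap_k \bigcup_(u : seq 'I_m.+1) ball (u, k)).
exists (fun n => if unpickle n is Some p then ball p else set0); split.
- apply: bigcapT_measurable => k; apply: countable_bigcupT_measurable => //.
  by move=> u; exact: mball.
- move=> n; case: unpickle => [p|]; [exact: mball|exact: measurable0].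
- move=> w k _; have k0 : 0 < k.+1%:R^-1 :> R by rewrite invr_gt0.
  have [N HN] := rsL w k0; exists (path_prefix w N) => //.
  by rewrite /ball/= trace_distC HN.
move=> S T ZT ST; apply: trace_dist_eq0; apply/eqP; rewrite eq_le trace_dist_ge0 andbT.
rewrite leNgt; apply/negP => d0.
have [k kd] := exists_natSinv_lt (divr_gt0 d0 (ltr0n _ 2)).
have [u _ uT] := ZT k I.
have /(_ (pickle (u, k))) := ST; rewrite pickleK => -[_ /(_ uT) uS].
have := trace_dist_triangle S (rs u) T; rewrite [trace_dist (rs u) T]trace_distC.
move: uT uS kd; rewrite /ball/=; set d := trace_dist S T.
by move: (_^-1) (trace_dist T _) (trace_dist S (rs u)) => i a b; lra.
Qed.

End borel_limit.

(** * Measures on the path space *)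

Section kolmogorov.
Context {R : realType} {m : nat}.
Local Notation Omega := (path_space m).
Local Notation word := (seq (alphabet m)).
Variable w : word -> R.
Hypotheses (w1 : w [::] = 1) (w0 : forall u, 0 <= w u)
  (wS : forall u, w u = \sum_(a : 'I_m.+1) w (rcons u a)).

Let below u k : R := \sum_(b : 'I_m.+1 | (b < k)%N) w (rcons u b).

Let below_le u k l : (k <= l)%N -> below u k <= below u l.
Proof.
move=> kl; rewrite /below [leRHS](bigID (fun b : 'I_m.+1 => (b < k)%N))/=.
rewrite (eq_bigl (fun b : 'I_m.+1 => (b < l)%N && (b < k)%N)) ?lerDl ?sumr_ge0//.
by move=> b; case: ltnP => bk; rewrite ?andbF// (leq_trans bk kl).
Qed.

Let belowS u (a : 'I_m.+1) : below u a.+1 = below u a + w (rcons u a).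
Proof.
rewrite /below (bigD1 a)//= addrC; congr (_ + _); apply: eq_bigl => b.
by rewrite ltnS -val_eqE /= [RHS]ltn_neqAle andbC.
Qed.

Let below0 u : below u 0 = 0.
Proof. by rewrite /below big_pred0. Qed.

Let belowT u : below u m.+1 = w u.
Proof. by rewrite wS /below; apply: eq_bigl => b; rewrite ltn_ord. Qed.

(** Left endpoint of the interval of [u]: at each level, the weights of the siblings that precede
    the prefix of [u] are added. *)
Let lo (u : word) : R := \sum_(0 <= i < size u) below (take i u) (nth (ord0 : 'I_m.+1) u i).

Let lo_rcons u (a : 'I_m.+1) : lo (rcons u a) = lo u + below u a.
Proof.
rewrite /lo size_rcons big_nat_recr//= nth_rcons ltnn eqxx; congr (_ + below _ _).
  by apply: eq_big_nat => i /andP[_ iu]; rewrite nth_rcons iu -cats1 takel_cat// ltnW.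
by rewrite -cats1 takel_cat// take_size.
Qed.

(* The words of a given length cut [0, 1[ into consecutive intervals of length w u. *)
Let cell u t := (lo u <= t) && (t < lo u + w u).

Let cell_rcons u (a : 'I_m.+1) t : cell (rcons u a) t =
  (lo u + below u a <= t) && (t < lo u + below u a.+1).
Proof. by rewrite /cell lo_rcons belowS addrA. Qed.

Let cell_sub u a t : cell (rcons u a) t -> cell u t.
Proof.
rewrite cell_rcons => /andP[at_ ta]; apply/andP; split.
  by rewrite (le_trans _ at_)// lerDl -[leLHS](below0 u) below_le.
by rewrite (lt_le_trans ta)// lerD2l -[leRHS]belowT below_le// ltn_ord.
Qed.

Let cell_exists u t : cell u t -> exists a, cell (rcons u a) t.
Proof.
move=> /andP[ut tu].
have : forall k, (k <= m.+1)%N -> t < lo u + below u k -> exists a : 'I_m.+1, cell (rcons u a) t.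
  elim=> [_|k IH km tk]; first by rewrite below0 addr0 ltNge ut.
  have [kt|] := leP (lo u + below u k) t; last by apply: IH; exact: ltnW.
  by exists (Ordinal km); rewrite cell_rcons kt.
by move=> /(_ m.+1 (leqnn _)); rewrite belowT; exact.
Qed.

Let cell_inj u (a b : 'I_m.+1) t : cell (rcons u a) t -> cell (rcons u b) t -> a = b.
Proof.
wlog ab : a b / (a <= b)%N.
  by case/orP: (leq_total a b) => h W ha hb; [exact: W|apply/esym; exact: W].
rewrite !cell_rcons => /andP[_ ta] /andP[bt _]; apply/val_inj/eqP => /=.
rewrite eqn_leq ab/= leqNgt; apply/negP => ab'.
have := lt_le_trans ta (le_trans _ bt); rewrite lerD2l below_le//.
by move=> /(_ isT); rewrite ltxx.
Qed.

(** The default letter matters only outside [[0, 1[]: a cell is the disjoint union of the cells of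
    its children. *)
Let next t u : 'I_m.+1 := odflt ord0 [pick a | cell (rcons u a) t].

Let pre t := fix pre n := if n is k.+1 then rcons (pre k) (next t (pre k)) else [::].

Let path t : Omega := fun n => next t (pre t n).

Let prefix_path t n : path_prefix (path t) n = pre t n.
Proof. by elim: n => // n IH; rewrite /path_prefix mkseqS -/(path_prefix _ _) IH. Qed.

Let cell_nil t : cell [::] t = (0 <= t < 1).
Proof. by rewrite /cell /lo big_geq// w1 add0r. Qed.

Let pre_cell t u : cell [::] t -> pre t (size u) = u <-> cell u t.
Proof.
move=> t01; elim/last_ind: u => [//|u a IH]; rewrite size_rcons/=; split.
  move=> /eqP; rewrite eqseq_rcons => /andP[/eqP pu /eqP <-].
  have /cell_exists[b hb] := IH.1 pu; rewrite pu /next.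
  by case: pickP => [//|/(_ b)]; rewrite hb.
move=> ua; have pu := IH.2 (cell_sub ua); rewrite pu /next.
case: pickP => [b hb|/(_ a)]; last by rewrite ua.
by rewrite (cell_inj hb ua).
Qed.

Let pre_out t n : ~~ cell [::] t -> pre t n = nseq n (ord0 : 'I_m.+1).
Proof.
move=> t01; have sub u : cell u t -> cell [::] t.
  by elim/last_ind: u => // u a IH /cell_sub.
have nseqSr k : rcons (nseq k (ord0 : 'I_m.+1)) ord0 = nseq k.+1 ord0.
  by elim: k => //= k ->.
elim: n => //= n ->; rewrite -[RHS]/(nseq n.+1 _) -nseqSr; congr rcons.
by rewrite /next; case: pickP => //= a /sub; rewrite (negPf t01).
Qed.

Let cellE u : [set t | cell u t] = `[lo u, lo u + w u[%classic.
Proof. by apply/seteqP; split=> t; rewrite /= in_itv. Qed.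

(** The second set collects the points outside [[0, 1[], all sent to the path constantly [ord0]; it
    is null for the uniform law. *)
Let preimage_cylinder u : path @^-1` cylinder u =
  [set t | cell u t] `|` (~` `[0, 1[%classic `&` [set t | nseq (size u) (ord0 : 'I_m.+1) = u]).
Proof.
have sub t : cell u t -> cell [::] t.
  by elim/last_ind: u => // u a IH /cell_sub.
apply/seteqP; split=> t; rewrite /cylinder /= prefix_path in_itv/= -cell_nil.
  have [t01|t01] := boolP (cell [::] t); first by move=> /(pre_cell _ t01); left.
  by rewrite pre_out//; right.
case=> [ut|[/negP t01 h]]; first by apply/pre_cell => //; exact: sub ut.
by rewrite pre_out.
Qed.

Let measurable_default u : measurable
  (~` `[0, 1[%classic `&` [set t | nseq (size u) (ord0 : 'I_m.+1) = u] : set R).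
Proof.
apply: measurableI; first by apply: measurableC; exact: measurable_itv.
have [h|h] := pselect (nseq (size u) (ord0 : 'I_m.+1) = u).
  by rewrite (_ : [set _ | _] = setT)//; apply/seteqP; split.
by rewrite (_ : [set _ | _] = set0)//; apply/seteqP; split.
Qed.

Let measurable_path : measurable_fun setT (path : measurableTypeR R -> borel Omega).
Proof.
apply: (@measurability _ _ _ (borel Omega) _ _ cylinders); first exact: borel_cylinders.
move=> _ [_ [->|[u ->]] <-]; rewrite setTI ?preimage_set0//.
rewrite preimage_cylinder; apply: measurableU; last exact: measurable_default.
by rewrite cellE; exact: measurable_itv.
Qed.

Let uniform_cell u : uniform_prob (@ltr01 R) [set t | cell u t] = (w u)%:E.
Proof.
have sub t : cell u t -> 0 <= t < 1.
  by rewrite -cell_nil; elim/last_ind: u => // u a IH /cell_sub.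
rewrite /uniform_prob (eq_integral (cst 1%E)) => [|t].
  rewrite integral_cst/= ?mul1e ?cellE ?lebesgue_measure_itv/=; last exact: measurable_itv.
  rewrite lte_fin ltrDl; case: ltP => [_|w_le0]; first by rewrite -EFinB addrC addKr.
  by apply/eqP; rewrite eqe eq_le w0.
rewrite inE /= => /sub /andP[t0 t1]; rewrite /uniform_pdf t0 (ltW t1)/=.
by rewrite subr0 invr1.
Qed.

Lemma kolmogorov_path_space :
  exists P : probability (borel Omega) R, forall u, P (cylinder u) = (w u)%:E.
Proof.
pose X : {mfun _ >-> borel Omega} := mfun_Sub (mem_set measurable_path).
pose P : probability _ R := uniform_prob (@ltr01 R).
have Pcell v : P [set t | cell v t] = (w v)%:E := uniform_cell v.
exists (distribution P X) => u.
rewrite /distribution /pushforward /= preimage_cylinder.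
have mcell v : measurable ([set t | cell v t] : set (measurableTypeR R)).
  by rewrite cellE; exact: measurable_itv.
have cellC : [set t | cell [::] t] = `[0, 1[%classic.
  by apply/seteqP; split=> t; rewrite /= cell_nil in_itv.
have mU : measurable (~` `[0, 1[%classic : set (measurableTypeR R)).
  by apply: measurableC; exact: measurable_itv.
set D := (X in _ `|` X); transitivity (P [set t | cell u t] + P D)%E.
  apply: (measureU P (mcell u) (measurable_default u)).
  apply/seteqP; split=> // t [/= ut [+ _]]; apply.
  rewrite /= in_itv/= -cell_nil; move: ut.
  by elim/last_ind: (u) => // v a IH /cell_sub.
rewrite Pcell -[RHS]adde0; congr (_ + _)%E; apply/eqP.
rewrite eq_le measure_ge0 andbT.
have <- : P (~` [set t | cell [::] t]) = 0%E.
  by rewrite probability_setC// Pcell w1 subee.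
rewrite cellC; apply: (le_measure P); rewrite ?inE//; last exact: subIsetl.
exact: measurable_default.
Qed.

End kolmogorov.

(** * Disintegration *)

Section joint_law.
Context d d' (X : measurableType d) (Y : measurableType d') (R : realType).
Variables (nu : probability X R) (phi : {mfun X >-> Y}) (E : set X).
Hypothesis mE : measurable E.
Local Open Scope ereal_scope.

(** The proof of measurability is an argument so that the measure structure can be attached to
    [joint_law mE]. *)
Definition joint_law of measurable E := fun B : set Y => nu (phi @^-1` B `&` E).

Let mpre B : measurable B -> measurable (phi @^-1` B).
Proof. by move=> mB; exact: measurable_sfunP. Qed.

Let joint_law0 : joint_law mE set0 = 0.
Proof. by rewrite /joint_law preimage_set0 set0I measure0. Qed.

Let joint_law_ge0 B : 0 <= joint_law mE B.
Proof. exact: measure_ge0. Qed.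

Let joint_law_sigma_additive : semi_sigma_additive (joint_law mE).
Proof.
move=> F mF tF mUF; rewrite /joint_law preimage_bigcup setI_bigcupl.
apply: measure_semi_sigma_additive => [n||].
- by apply: measurableI => //; exact: mpre.
- apply/trivIsetP => i j _ _ ij; rewrite setIACA setIid -preimage_setI.
  by move/trivIsetP : tF => /(_ _ _ _ _ ij) ->//; rewrite preimage_set0 set0I.
- by apply: bigcupT_measurable => n; apply: measurableI => //; exact: mpre.
Qed.

HB.instance Definition _ := isMeasure.Build _ _ _ (joint_law mE)
  joint_law0 joint_law_ge0 joint_law_sigma_additive.

Let joint_law_fin : fin_num_fun (joint_law mE).
Proof.
move=> B mB; rewrite ge0_fin_numE// (@le_lt_trans _ _ 1)%E ?ltry//.
by apply: probability_le1; apply: measurableI => //; exact: mpre.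
Qed.

HB.instance Definition _ := Measure_isFinite.Build _ _ _ (joint_law mE) joint_law_fin.

(** Dropping the intersection with [E] bounds the joint law by the law of [phi], so Radon-Nikodym
    applies. *)
Lemma joint_law_density : exists f : Y -> \bar R, [/\ forall y, 0 <= f y,
  forall y, f y \is a fin_num, measurable_fun setT f &
  forall B, measurable B -> nu (phi @^-1` B `&` E) = \int[distribution nu phi]_(y in B) f y].
Proof.
have dom : joint_law mE `<< distribution nu phi.
  apply/null_content_dominatesP => B mB B0; apply/eqP; rewrite eq_le measure_ge0 andbT.
  by rewrite -[leRHS]B0; apply: le_measure; rewrite ?inE//;
    [apply: measurableI => //; exact: mpre|exact: mpre].
have [f [f0 ffin fint fE]] := radon_nikodym_sigma_finite dom.
by exists f; split=> //; exact: measurable_int fint.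
Qed.

End joint_law.

Section disintegration.
Context d (Y : measurableType d) (R : realType) (m : nat).
Local Notation Omega := (borel (path_space m)).
Local Notation word := (seq (alphabet m)).
Variables (nu : probability Omega R) (phi : {mfun Omega >-> Y}).
Local Notation mu := (distribution nu phi).
Local Open Scope ereal_scope.

Let mcyl u : measurable (cylinder u : set Omega) := measurable_cylinder u.

Lemma cylinder_rcons (u : word) :
  cylinder u = \big[setU/set0]_(a < m.+1) cylinder (rcons u a) :> set (path_space m).
Proof.
rewrite -bigcup_mkord_ord; apply/seteqP; split=> [w uw|w [a _]].
  exists (w (size u)) => /=; first exact: (ltn_ord (w (size u) : 'I_m.+1)).
  rewrite inord_val /cylinder/= size_rcons /path_prefix mkseqS.
  by congr rcons; exact: uw.
rewrite /cylinder/= size_rcons /path_prefix mkseqS => /eqP.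
by rewrite eqseq_rcons => /andP[/eqP].
Qed.

Let trivIset_cylinder (u : word) :
  trivIset setT (fun a : 'I_m.+1 => cylinder (rcons u a) : set (path_space m)).
Proof.
apply/trivIsetP => a b _ _ ab; apply/seteqP; split=> // w [].
rewrite /cylinder/= !size_rcons => -> /eqP; rewrite eqseq_rcons => /andP[_].
by rewrite (negPf ab).
Qed.

(** The density of [u] and the sum of the densities of its children have equal integrals over every
    measurable set, hence agree almost everywhere; enumerating the words by [pickle] puts all
    exceptions into one null set [N]. *)
Lemma cylinder_density : exists (f : word -> Y -> R) (N : set Y),
  [/\ forall u, measurable_fun setT (f u), forall u y, (0 <= f u y)%R,
      forall u B, measurable B ->
        nu (phi @^-1` B `&` cylinder u) = \int[mu]_(y in B) (f u y)%:E,
      measurable N /\ mu N = 0 &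
      forall y, ~ N y -> f [::] y = 1%R /\
        forall u, f u y = (\sum_(a : 'I_m.+1) f (rcons u a) y)%R].
Proof.
have [g gP] := choice (fun u => joint_law_density nu phi (mcyl u)).
have gE u y : (fine (g u y))%:E = g u y by have [_ gf _ _] := gP u; rewrite fineK.
have g0 u y : 0 <= g u y by have [] := gP u.
have mg u : measurable_fun setT (g u) by have [] := gP u.
have mgB u B : measurable_fun B (g u) by exact: measurable_funTS.
have gI u B : measurable B -> nu (phi @^-1` B `&` cylinder u) = \int[mu]_(y in B) g u y.
  by have [_ _ _] := gP u; exact.
have mpre B : measurable B -> measurable (phi @^-1` B).
  by move=> mB; exact: measurable_sfunP.
have intg u : mu.-integrable setT (g u).
  apply/integrableP; split; first exact: mg.
  under eq_integral do rewrite gee0_abs//.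
  rewrite -gI// (@le_lt_trans _ _ 1)%E ?ltry//; apply: probability_le1.
  by apply: measurableI => //; exact: mpre.
have ae1 : ae_eq mu setT (g [::]) (cst 1).
  apply: integral_ae_eq => // B _ mB; rewrite -gI// integral_cst// mul1e; congr (nu _).
  by apply/seteqP; split=> [w []//|w]; split.
have aeS u : ae_eq mu setT (g u) (fun y => \sum_(a : 'I_m.+1) g (rcons u a) y).
  apply: integral_ae_eq => //.
    by apply: emeasurable_sum.
  move=> B _ mB; rewrite ge0_integral_sum// -gI//.
  rewrite setIC -[LHS]/(mrestr nu (mpre _ mB) (cylinder u)) cylinder_rcons.
  rewrite measure_bigsetU_ord//; apply: eq_bigr => a _.
  transitivity (nu (cylinder (rcons u a) `&` phi @^-1` B)) => //.
  by rewrite setIC gI.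
pose C n y := if unpickle n is Some u then
  g (u : seq 'I_m.+1) y = \sum_(a : 'I_m.+1) g (rcons u a) y else True.
have [N [mN N0 CN]] : \forall y \ae mu, g [::] y = 1 /\ forall n, C n y.
  apply: filterI.
    by move: ae1; apply: filterS => y; exact.
  apply: ae_foralln => n; rewrite /C; case: unpickle => [u|]; last exact: aeW.
  by move: (aeS u); apply: filterS => y; exact.
exists (fun u y => fine (g u y)), N; split=> //.
- by move=> u; apply: measurableT_comp => //; exact: fine_measurable.
- by move=> u y; rewrite fine_ge0.
- by move=> u B mB; rewrite gI//; apply: eq_integral => y _; rewrite gE.
- move=> y Ny; have [g1 Cy] : g [::] y = 1 /\ forall n, C n y.
    by apply: contrapT => /CN.
  split=> [|u]; first by rewrite g1.
  apply/EFin_inj; rewrite gE -sumEFin; have := Cy (pickle (u : seq 'I_m.+1)).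
  by rewrite /C pickleK => ->; apply: eq_bigr => a _; rewrite gE.
Qed.

End disintegration.

Section disintegration_kernel.
Context d (Y : measurableType d) (R : realType) (m : nat).
Local Notation Omega := (borel (path_space m)).
Local Notation word := (seq (alphabet m)).
Variables (nu : probability Omega R) (phi : {mfun Omega >-> Y}).
Local Notation mu := (distribution nu phi).
Local Open Scope ereal_scope.

Lemma dirac_word_consistent (u : word) : (u == nseq (size u) (ord0 : 'I_m.+1))%:R =
  (\sum_(a : 'I_m.+1) (rcons u a == nseq (size (rcons u a)) (ord0 : 'I_m.+1))%:R :> R)%R.
Proof.
have nseqSr k : nseq k.+1 (ord0 : 'I_m.+1) = rcons (nseq k ord0) ord0.
  by elim: k => //= k ->.
have E a : (rcons u a == nseq (size (rcons u a)) (ord0 : 'I_m.+1)) =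
    (u == nseq (size u) (ord0 : 'I_m.+1)) && (a == ord0).
  by rewrite size_rcons nseqSr eqseq_rcons.
rewrite (bigD1 ord0)//= E eqxx andbT big1 ?addr0// => a a0.
by rewrite E (negPf a0) andbF.
Qed.

Lemma disintegration_kernel : exists k : R.-pker Y ~> Omega,
  forall E B, measurable E -> measurable B ->
    nu (phi @^-1` B `&` E) = \int[mu]_(y in B) k y E.
Proof.
have [f [N [mf f0 fI [mN N0] fN]]] := cylinder_density nu phi.
(* On [N] the weights are those of the point mass at the path constantly [ord0]. *)
pose w y (u : word) : R := if y \in N then (u == nseq (size u) (ord0 : 'I_m.+1))%:R else f u y.
have /choice[K KE] y : exists P : probability Omega R, forall u, P (cylinder u) = (w y u)%:E.
  have [yN|yN] := pselect (N y).
    have wE u : w y u = (u == nseq (size u) (ord0 : 'I_m.+1))%:R by rewrite /w mem_set.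
    apply: kolmogorov_path_space => [|u|u]; rewrite !wE ?ler0n//.
    by rewrite dirac_word_consistent; apply: eq_bigr => a _; rewrite wE.
  have wE u : w y u = f u y by rewrite /w memNset.
  have [f1 fS] := fN y yN.
  apply: kolmogorov_path_space => [|u|u]; rewrite !wE ?f1//.
  by rewrite fS; apply: eq_bigr => a _; rewrite wE.
have mw u : measurable_fun setT (fun y => (w y u)%:E).
  apply/measurable_EFinP; apply: measurable_fun_ifT => //.
  apply: (measurable_fun_bool true); rewrite setTI (_ : _ @^-1` _ = N)//.
  by apply/seteqP; split=> y /=; [exact: set_mem|exact: mem_set].
have KcylE u : (fun y => K y (cylinder u)) = fun y => (w y u)%:E.
  by apply/funext => y; rewrite KE.
have aew u : ae_eq mu setT (fun y => (w y u)%:E) (fun y => (f u y)%:E).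
  exists N; split=> // y /= h; apply: contrapT => yN; apply: h => _.
  by rewrite /w memNset.
have mphi B : measurable B -> measurable (phi @^-1` B).
  by move=> mB; exact: measurable_sfunP.
(* Measurability in [y] and the integral identity are proved together, because the complement and
   union steps of the Dynkin argument integrate the kernel. *)
pose P E := measurable_fun setT (fun y => K y E) /\ forall B, measurable B ->
  nu (phi @^-1` B `&` E) = \int[mu]_(y in B) K y E.
have P0 : P setT.
  split=> [|B mB].
    by rewrite (_ : (fun y => _) = cst 1) //; apply/funext => y; rewrite probability_setT.
  rewrite setIT (eq_integral (cst 1)) => [|y _]; last by rewrite /= probability_setT.
  by rewrite integral_cst// mul1e.
have KP E : measurable E -> P E.
  move=> mE; have := mE; rewrite (@borel_cylinders m).
  apply: (@dynkin_induction _ Omega (@cylinders m) P) => //.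
  - exact: borel_cylinders.
  - exact: setI_closed_cylinders.
  - move=> A [->|[u ->]]; split=> [|B mB].
    + by rewrite (_ : (fun y => _) = cst 0) //; apply/funext => y; rewrite measure0.
    + rewrite setI0 measure0 (eq_integral (cst 0)) ?integral0// => y _.
      by rewrite measure0.
    + by rewrite KcylE.
    + rewrite fI// KcylE; apply: ae_eq_integral => //.
      * by apply: measurable_funTS; apply/measurable_EFinP.
      * exact: measurable_funTS.
      * exact: ae_eq_subset (subsetT B) (ae_eq_sym (aew u)).
  - move=> S mS [mKS KS].
    have KC : (fun y => K y (~` S)) = (fun y => 1 - K y S).
      by apply/funext => y; rewrite probability_setC.
    have mKC : measurable_fun setT (fun y => K y (~` S)).
      by rewrite KC; apply: emeasurable_funB.
    split=> // B mB.
    have fin1 : nu (phi @^-1` B `&` S) \is a fin_num.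
      by apply: fin_num_measure; apply: measurableI; [exact: mphi|exact: mS].
    have sum1 : \int[mu]_(y in B) K y S + \int[mu]_(y in B) K y (~` S) = nu (phi @^-1` B).
      rewrite -ge0_integralD//; try exact: measurable_funTS.
      rewrite (eq_integral (cst 1)) ?integral_cst ?mul1e// => y _.
      by rewrite probability_setC// addeC subeK// fin_num_measure.
    transitivity (nu (phi @^-1` B) - nu (phi @^-1` B `&` S)).
      rewrite -setDE measureD//; first exact: mphi.
      by rewrite ltey_eq fin_num_measure//; exact: mphi.
    by rewrite -sum1 -KS// [X in X - _]addeC addeK.
  - move=> F mF tF PF; have KU : (fun y => K y (\bigcup_n F n)) = fun y => \sum_(n <oo) K y (F n).
      by apply/funext => y; rewrite measure_semi_bigcup//; exact: bigcupT_measurable.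
    have mKF n : measurable_fun setT (fun y => K y (F n)) by have [] := PF n.
    split=> [|B mB]; first by rewrite KU; exact: ge0_emeasurable_sum.
    rewrite KU integral_nneseries//; last by move=> n; exact: measurable_funTS.
    rewrite setI_bigcupr measure_semi_bigcup.
    + by apply: eq_eseriesr => n _; exact: (PF n).2 B mB.
    + by move=> n; apply: measurableI; [exact: mphi|exact: mF].
    + exact: trivIset_setIl.
    + by apply: bigcupT_measurable => n; apply: measurableI; [exact: mphi|exact: mF].
(* The sigma-algebra on [pprobability] is generated by the conditions that a measurable set have
   mass below a level. *)
have mK : measurable_fun setT (K : Y -> pprobability Omega R).
  apply: (measurability (@pset _ _ _ : set (set (pprobability Omega R)))) => //.
  move=> _ -[_ [r r01] [E mE <-]] <-.
  by apply: emeasurable_fun_infty_o => //; have [] := KP E mE.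
exists (kprobability mK) => E B mE mB.
by have [_ ->] := KP E mE.
Qed.

End disintegration_kernel.

Section integral_disintegration.
Context d d' (Z : measurableType d) (Y : measurableType d') (R : realType).
Variables (N : {measure set Z -> \bar R}) (M : {measure set Y -> \bar R}).
Variables (k : R.-ker Y ~> Z) (D : set Z) (B : set Y).
Hypotheses (mD : measurable D) (mB : measurable B).
Hypothesis NE : forall E, measurable E -> (N (D `&` E) = \int[M]_(y in B) k y E)%E.
Local Open Scope ereal_scope.

Import HBNNSimple.

Let mk E : measurable E -> measurable_fun B (k ^~ E).
Proof. by move=> mE; apply: measurable_funTS; exact: measurable_kernel. Qed.

Let integral_disintegration_nnsfun (f : {nnsfun Z >-> R}) :
  \int[N]_(z in D) (f z)%:E = \int[M]_(y in B) \int[k y]_z (f z)%:E.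
Proof.
have term (L : {measure set Z -> \bar R}) A r : measurable A ->
    \int[L]_(z in A) (r * \1_(f @^-1` [set r]) z)%:E = r%:E * L (f @^-1` [set r] `&` A).
  move=> mA; rewrite (integralZl_indic mA (fun r => f @^-1` [set r]))//; last first.
    by move=> r0; rewrite preimage_nnfun0.
  by rewrite integral_indic.
have fE (L : {measure set Z -> \bar R}) A : measurable A ->
    \int[L]_(z in A) (f z)%:E = \sum_(r \in range f) r%:E * L (f @^-1` [set r] `&` A).
  move=> mA; under eq_integral do rewrite fimfunE -fsumEFin//.
  rewrite ge0_integral_fsum//; last 2 first.
  - move=> r; apply: measurable_funTS.
    by apply/measurable_EFinP/measurableT_comp.
  - by move=> r z _; rewrite EFinM nnfun_muleindic_ge0.
  by apply: eq_fsbigr => r _; exact: term.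
rewrite fE//; under [RHS]eq_integral do rewrite fE//.
rewrite ge0_integral_fsum//; last 2 first.
- move=> r; apply: measurable_funeM; apply: mk.
  by apply: measurableI.
- move=> r y _; have := mulemu_ge0 (fun r => f @^-1` [set r] `&` setT).
  by apply=> r0; rewrite preimage_nnfun0// set0I.
apply: eq_fsbigr => r _; rewrite setIC NE//.
have [r0|r0] := leP 0%R r.
  rewrite -ge0_integralZl//; last exact: mk.
  by apply: eq_integral => y _; rewrite setIT.
rewrite !(integral0_eq, mule0)// => y _; first by rewrite preimage_nnfun0// set0I measure0 mule0.
by rewrite preimage_nnfun0// measure0.
Qed.

(** The hypothesis [NE] handles the level sets of simple functions; monotone convergence is then
    used for [N], for each [k y] and for [M]. *)
Lemma ge0_integral_disintegration (f : Z -> \bar R) : (forall z, 0 <= f z) ->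
  measurable_fun setT f -> \int[N]_(z in D) f z = \int[M]_(y in B) \int[k y]_z f z.
Proof.
move=> f0 mf; pose f_ := nnsfun_approx measurableT mf.
have f_f z : (f_ n z)%:E @[n --> \oo] --> f z by exact: cvg_nnsfun_approx.
have mf_ n A : measurable_fun A (fun z => (f_ n z)%:E).
  by apply: measurable_funTS; exact/measurable_EFinP.
have mono z a b : (a <= b)%N -> (f_ a z)%:E <= (f_ b z)%:E.
  by move=> ab; rewrite lee_fin; exact/lefP/nd_nnsfun_approx.
have lim_int (L : {measure set Z -> \bar R}) A : measurable A ->
    \int[L]_(z in A) f z = lim ((\int[L]_(z in A) (f_ n z)%:E) @[n --> \oo]).
  move=> mA; rewrite -monotone_convergence//.
  - by apply: eq_integral => z _; apply/esym/cvg_lim.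
  - by move=> n z _; rewrite lee_fin.
  - by move=> z _ a b; exact: mono.
rewrite lim_int//; under [RHS]eq_integral do rewrite lim_int//.
rewrite monotone_convergence//.
- apply: (congr1 (fun u : nat -> \bar R => limn u)); apply/funext => n.
  exact: integral_disintegration_nnsfun.
- move=> n; apply: measurable_funTS; apply: measurable_fun_integral_kernel => //.
  + by move=> U mU; exact: measurable_kernel.
  + by move=> z; rewrite lee_fin.
- by move=> n y _; apply: integral_ge0 => z _; rewrite lee_fin.
- move=> y _ a b ab; apply: ge0_le_integral => //.
  + by move=> z _; rewrite lee_fin.
  + by move=> z _; exact: mono.
Qed.

End integral_disintegration.

(** * Concentration on the fibres and integrals against the kernel *)

Section conditional_law.
Context d d' (X : measurableType d) (Y : measurableType d') (R : realType).
Variables (nu : probability X R) (phi : {mfun X >-> Y}) (k : R.-pker Y ~> X).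
Local Notation mu := (distribution nu phi).
Hypothesis kE : forall E B, measurable E -> measurable B ->
  (nu (phi @^-1` B `&` E) = \int[mu]_(y in B) k y E)%E.
Local Open Scope ereal_scope.

Let mphi B : measurable B -> measurable (phi @^-1` B).
Proof. by move=> mB; exact: measurable_sfunP. Qed.

Let kernel_setC y A : measurable A -> k y (~` A) = 1 - k y A.
Proof.
move=> mA; have := prob_kernel (s := k) y.
rewrite -(setUv A) measureU ?setICr//; last exact: measurableC.
move=> kA; have kfin : k y A \is a fin_num.
  rewrite ge0_fin_numE// (@le_lt_trans _ _ 1) ?ltry//.
  by rewrite -kA leeDl.
by rewrite -kA [X in X - _]addeC addeK.
Qed.

Lemma ae_pushforward (P : Y -> Prop) : (\forall y \ae mu, P y) ->
  \forall x \ae nu, P (phi x).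
Proof.
move=> [N [mN N0 PN]]; exists (phi @^-1` N); split=> //; first exact: mphi.
by move=> x /= /PN.
Qed.

(** The indicator of [B n] and the kernel mass of its preimage have equal integrals over every
    measurable set. Hence, for almost every [y] and all n at once, that mass is 1 or 0 according to
    whether [y] lies in [B n]. *)
Lemma kernel_fiber (Z : set Y) (B : nat -> set Y) :
  measurable Z -> (forall n, measurable (B n)) -> (forall x, Z (phi x)) ->
  (forall y z, Z z -> (forall n, B n y <-> B n z) -> y = z) ->
  \forall y \ae mu, k y [set x | phi x = y] = 1.
Proof.
move=> mZ mB Zphi sep.
have aeB n : \forall y \ae mu, (\1_(B n) y)%:E = k y (phi @^-1` (B n)).
  suff : ae_eq mu setT (fun y => (\1_(B n) y)%:E) (fun y => k y (phi @^-1` (B n))).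
    by apply: filterS => y; exact.
  apply: integral_ae_eq => //.
  - exact: integrable_indic.
  - by apply: measurable_kernel; exact: mphi.
  - move=> C _ mC; rewrite -kE//; last exact: mphi.
    by rewrite integral_indic// setIC.
have aeZ : \forall y \ae mu, Z y.
  exists (~` Z); split=> //; first exact: measurableC.
  rewrite /distribution /pushforward (_ : _ @^-1` _ = set0) ?measure0//.
  by apply/seteqP; split=> x //=; apply; exact: Zphi.
apply: filterS2 aeZ (ae_foralln aeB) => y Zy yB.
(* Each [A n] has full mass under [k y], and since [y] is in [Z] the separation property makes their
   intersection the fibre over [y]. *)
pose A n := if `[< B n y >] then phi @^-1` (B n) else ~` (phi @^-1` (B n)).
have mA n : measurable (A n).
  by rewrite /A; case: asboolP => _; [|apply: measurableC]; exact: mphi.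
have -> : [set x | phi x = y] = ~` \bigcup_n ~` A n.
  apply/seteqP; split=> [x /= xy [n _]|x /= xA].
    by rewrite /A; case: asboolP => /=; rewrite xy.
  apply: sep => // n; have : A n x by apply: contrapT => nA; apply: xA; exists n.
  by rewrite /A; case: asboolP => /= h; split.
have mU : measurable (\bigcup_n ~` A n).
  by apply: bigcupT_measurable => n; exact: measurableC.
have kA n : k y (~` A n) = 0.
  have := yB n; rewrite /A indicE; case: asboolP => By.
    rewrite mem_set// => kyB; rewrite kernel_setC; last exact: mphi.
    by rewrite -kyB subee.
  by rewrite memNset// setCK => <-.
rewrite kernel_setC// [X in 1 - X](_ : _ = 0) ?sube0//.
apply/negligibleP => //; apply: negligible_bigcup => n.
by apply/negligibleP; [exact: measurableC|exact: kA].
Qed.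

Section real_function.
Variable r : X -> R.
Hypothesis ir : nu.-integrable setT (EFin \o r).
Let p := (EFin \o r)^\+.
Let q := (EFin \o r)^\-.

Let mr : measurable_fun setT (EFin \o r).
Proof. exact: measurable_int ir. Qed.

Let mp : measurable_fun setT p. Proof. exact: measurable_funepos. Qed.
Let mq : measurable_fun setT q. Proof. exact: measurable_funeneg. Qed.

Let p0 x : 0 <= p x. Proof. exact: funepos_ge0. Qed.
Let q0 x : 0 <= q x. Proof. exact: funeneg_ge0. Qed.

Let I (f : X -> \bar R) y := \int[k y]_x f x.

Let mI f : measurable_fun setT f -> (forall x, 0 <= f x) -> measurable_fun setT (I f).
Proof.
move=> mf f0; apply: measurable_fun_integral_kernel => // U mU.
exact: measurable_kernel.
Qed.

Let I_ge0 f : (forall x, 0 <= f x) -> forall y, 0 <= I f y.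
Proof. by move=> f0 y; exact: integral_ge0. Qed.

Let IE f B : measurable_fun setT f -> (forall x, 0 <= f x) -> measurable B ->
  \int[nu]_(x in phi @^-1` B) f x = \int[mu]_(y in B) I f y.
Proof.
move=> mf f0 mB; apply: ge0_integral_disintegration => // [|E mE]; first exact: mphi.
exact: kE.
Qed.

Let I_integrable f : measurable_fun setT f -> (forall x, 0 <= f x) ->
  \int[nu]_x f x < +oo -> mu.-integrable setT (I f).
Proof.
move=> mf f0 foo; apply/integrableP; split; first exact: mI.
under eq_integral do rewrite gee0_abs ?I_ge0//.
by rewrite -IE.
Qed.

Let iIp : mu.-integrable setT (I p).
Proof. by apply: I_integrable => //; exact: (integral_funepos_lt_pinfty measurableT ir). Qed.

Let iIq : mu.-integrable setT (I q).
Proof. by apply: I_integrable => //; exact: (integral_funeneg_lt_pinfty measurableT ir). Qed.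

(** [Rintegral] makes this real for every [y]; it represents [I p - I q] where both are finite,
    which is almost everywhere. *)
Let h y : R := \int[k y]_x r x.

Let hE y : h y = fine (I p y - I q y).
Proof. by rewrite /h /Rintegral integralE. Qed.

Let Ifin : \forall y \ae mu, I p y \is a fin_num /\ I q y \is a fin_num.
Proof.
have := integrable_ae measurableT iIp; have := integrable_ae measurableT iIq.
by apply: filterS2 => y /(_ Logic.I) ? /(_ Logic.I).
Qed.

Lemma ae_kernel_integrable : \forall y \ae mu, (k y).-integrable setT (EFin \o r).
Proof.
move: Ifin; apply: filterS => y [Ipf Iqf]; apply/integrableP; split=> //.
under eq_integral do rewrite -/((abse \o (EFin \o r)) _) fune_abse.
by rewrite ge0_integralD//= lte_add_pinfty// ltey_eq ?Ipf ?Iqf.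
Qed.

Lemma measurable_kernel_Rintegral : measurable_fun setT h.
Proof.
rewrite (_ : h = fine \o (I p \- I q)); last by apply/funext => y; rewrite hE.
apply: measurableT_comp; first exact: fine_measurable.
by apply: emeasurable_funB; exact: mI.
Qed.

Let h_ae : ae_eq mu setT (I p \- I q) (EFin \o h).
Proof.
by move: Ifin; apply: filterS => y [Ipf Iqf] _ /=; rewrite hE fineK// fin_numB Ipf.
Qed.

Let ih : mu.-integrable setT (EFin \o h).
Proof.
have mh : measurable_fun setT (EFin \o h).
  by apply/measurable_EFinP; exact: measurable_kernel_Rintegral.
have /integrableP[mpq pqoo] := integrableB measurableT iIp iIq.
apply/integrableP; split=> //; apply: le_lt_trans pqoo; rewrite le_eqVlt; apply/orP; left.
apply/eqP/ge0_ae_eq_integral => //; try exact: measurableT_comp.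
by apply: ae_eq_sym; exact: ae_eq_abse h_ae.
Qed.

Lemma integrable_kernel_Rintegral : nu.-integrable setT (EFin \o (h \o phi)).
Proof.
apply/integrableP; split.
  by apply/measurable_EFinP; apply: measurableT_comp => //; exact: measurable_kernel_Rintegral.
have /integrableP[mh hoo] := ih.
move: hoo; rewrite /distribution ge0_integral_pushforward//.
exact: measurableT_comp.
Qed.

(** A change of variables moves the integral to [mu], where [h] may be replaced by [I p - I q]; the
    positive and negative parts are then disintegrated separately. *)
Lemma integral_kernel_Rintegral B : measurable B ->
  (\int[nu]_(x in phi @^-1` B) h (phi x) = \int[nu]_(x in phi @^-1` B) r x)%R.
Proof.
move=> mB; rewrite /Rintegral; congr fine.
have /integrableP[mh _] := ih.
transitivity (\int[mu]_(y in B) (EFin \o h) y).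
  rewrite /distribution integral_pushforward//.
  by apply: integrableS integrable_kernel_Rintegral => //; exact: mphi.
rewrite -(ae_eq_integral _ _ _ _ _ (ae_eq_subset (subsetT B) h_ae))//; last 2 first.
- by apply: measurable_funTS; apply: emeasurable_funB; exact: mI.
- exact: measurable_funTS.
rewrite integralB//; [|exact: integrableS iIp|exact: integrableS iIq].
by rewrite -!IE// -integralE.
Qed.

End real_function.
End conditional_law.

(** * Conditional expectations *)

Section conditional_uniqueness.
Context d d' (X : measurableType d) (Y : measurableType d') (R : realType).
Variables (nu : {measure set X -> \bar R}) (phi : X -> Y).
Hypothesis mphi : measurable_fun setT phi.
Local Notation G := (preimage_set_system setT phi measurable).

(** The set where a < b is the union over rationals q of the sets a < q < b, hence lies in the
    sigma-field and may be used as a test set. On it b - a is positive with integral 0. *)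
Let ae_ge (a b : X -> R) :
  (forall B : set R, measurable B -> G (a @^-1` B)) ->
  (forall B : set R, measurable B -> G (b @^-1` B)) ->
  nu.-integrable setT (EFin \o a) -> nu.-integrable setT (EFin \o b) ->
  (forall A, G A -> \int[nu]_(x in A) a x = \int[nu]_(x in A) b x) ->
  \forall x \ae nu, b x <= a x.
Proof.
move=> Ga Gb ia ib ab.
have mG A : G A -> measurable A by move=> [C mC <-]; exact: mphi.
have /choice[C CP] (q : rat) : exists C : set Y, measurable C /\
    phi @^-1` C = [set x | a x < ratr q < b x].
  have [C1 mC1 C1E] := Ga `]-oo, ratr q[%classic (measurable_itv _).
  have [C2 mC2 C2E] := Gb `]ratr q, +oo[%classic (measurable_itv _).
  exists (C1 `&` C2); split; first exact: measurableI.
  rewrite !setTI in C1E C2E; rewrite preimage_setI C1E C2E.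
  by apply/seteqP; split=> x /=; rewrite !in_itv/= andbT => /andP.
pose A := [set x | a x < b x].
have AE : A = phi @^-1` (\bigcup_q C q).
  rewrite preimage_bigcup; apply/seteqP; split=> x.
    by move=> /rat_in_itvoo[q] /[!in_itv]/= h; exists q => //; have [_ ->] := CP q.
  by move=> [q _]; have [_ ->] := CP q => /andP[]; exact: lt_trans.
have GA : G A.
  rewrite AE; exists (\bigcup_q C q); last by rewrite setTI.
  by apply: countable_bigcupT_measurable => // q; have [] := CP q.
have mA := mG _ GA.
have ia' : nu.-integrable A (EFin \o a) by exact: integrableS ia.
have ib' : nu.-integrable A (EFin \o b) by exact: integrableS ib.
have int0 : (\int[nu]_(x in A) `|(b x)%:E - (a x)%:E| = 0)%E.
  rewrite (eq_integral ((EFin \o b) \- (EFin \o a))%E); last first.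
    move=> x; rewrite inE => xA; rewrite gee0_abs//= -EFinB lee_fin subr_ge0.
    exact: ltW.
  rewrite integralB// -(fineK (integrable_fin_num mA ia')).
  rewrite -(fineK (integrable_fin_num mA ib')).
  by have := ab _ GA; rewrite /Rintegral => ->; rewrite -EFinB subrr.
have mba : measurable_fun A (fun x => (b x)%:E - (a x)%:E)%E.
  by apply: emeasurable_funB; [exact: measurable_int ib'|exact: measurable_int ia'].
have := (ae_eq_integral_abs nu mA mba).1 int0; apply: filterS => x /= h.
rewrite leNgt; apply/negP => xA; have := h xA.
by case=> /eqP; rewrite subr_eq0 gt_eqF.
Qed.

Lemma ae_eq_sigma_algebra_preimage (a b : X -> R) :
  (forall B : set R, measurable B -> G (a @^-1` B)) ->
  (forall B : set R, measurable B -> G (b @^-1` B)) ->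
  nu.-integrable setT (EFin \o a) -> nu.-integrable setT (EFin \o b) ->
  (forall A, G A -> \int[nu]_(x in A) a x = \int[nu]_(x in A) b x) ->
  \forall x \ae nu, a x = b x.
Proof.
move=> Ga Gb ia ib ab.
have ab1 := ae_ge Ga Gb ia ib ab.
have ab2 := ae_ge Gb Ga ib ia (fun A GA => esym (ab A GA)).
by apply: filterS2 ab1 ab2 => x ba ab'; apply/eqP; rewrite eq_le ba ab'.
Qed.

End conditional_uniqueness.

Theorem theorem7p2 (R : realType) (H : hilbertType R) (m : nat)
    (hm : (1 <= m)%N) (R0 : pos_trace_class H) (C : 'I_m -> H -> H)
    (hC : forall j : 'I_m, contraction_op (C j))
    (nu : probability (borel (path_space m)) R)
    (hnu : trace_biased R0 C nu) :
  let Rinf : borel (path_space m) -> borel (pos_trace_class H) :=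
    residual_lim R0 C in
  let mu : set (borel (pos_trace_class H)) -> \bar R := pushforward nu Rinf in
  exists k : R.-pker (borel (pos_trace_class H)) ~> (borel (path_space m)),
  [/\ forall E : set (borel (path_space m)), measurable E ->
        measurable_fun setT (k ^~ E) /\
        nu E = (\int[mu]_T k T E)%E,
      \forall T \ae mu, k T [set omega | Rinf omega = T] = 1%E &
      forall f : borel (path_space m) -> R[i], cintegrable nu f ->
        (exists g, is_cond_exp nu (g_sigma_algebra_preimage Rinf) f g) /\
        forall g, is_cond_exp nu (g_sigma_algebra_preimage Rinf) f g ->
          \forall omega \ae nu,
            cintegrable (k (Rinf omega)) f /\
            g omega = cintegral (k (Rinf omega)) setT f].
Proof.
move=> Rinf mu; have [rs rsL] := residual_lim_cvg R0 hC.
have mR : measurable_fun setT Rinf by exact: measurable_trace_limit rsL.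
pose phi : {mfun borel (path_space m) >-> borel (pos_trace_class H)} :=
  mfun_Sub (mem_set mR).
have [k kE] := disintegration_kernel nu phi.
have [Z [B [mZ mB ZL sep]]] := trace_limit_separating rsL.
exists k; split=> [E mE||f [ire iim]].
- split; first exact: measurable_kernel.
  by rewrite -[LHS](congr1 nu (setTI E)) -[X in nu (X `&` _)](preimage_setT phi) kE.
- exact: (kernel_fiber kE mZ mB ZL sep).
pose hr T := \int[k T]_x complex.Re (f x); pose hi T := \int[k T]_x complex.Im (f x).
have mhr : measurable_fun setT hr by exact: (measurable_kernel_Rintegral k ire).
have mhi : measurable_fun setT hi by exact: (measurable_kernel_Rintegral k iim).
have Gh (h : borel (pos_trace_class H) -> R) (D : set R) : measurable_fun setT h ->
    measurable D -> g_sigma_algebra_preimage Rinf ((h \o Rinf) @^-1` D).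
  by move=> mh mD; exists (h @^-1` D); rewrite ?setTI// -[X in measurable X]setTI; exact: mh.
have ihr := integrable_kernel_Rintegral kE ire.
have ihi := integrable_kernel_Rintegral kE iim.
have Ehr A : g_sigma_algebra_preimage Rinf A ->
    \int[nu]_(x in A) hr (Rinf x) = \int[nu]_(x in A) complex.Re (f x).
  by move=> [D mD <-]; rewrite setTI; exact: (integral_kernel_Rintegral kE ire).
have Ehi A : g_sigma_algebra_preimage Rinf A ->
    \int[nu]_(x in A) hi (Rinf x) = \int[nu]_(x in A) complex.Im (f x).
  by move=> [D mD <-]; rewrite setTI; exact: (integral_kernel_Rintegral kE iim).
split=> [|g [Gg [igr igi] gE]].
  exists (fun x => Complex (hr (Rinf x)) (hi (Rinf x))); split=> //.
  - by move=> D mD; split; exact: Gh.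
  - by move=> A GA; rewrite /cintegral /= Ehr// Ehi.
have gr : \forall x \ae nu, complex.Re (g x) = hr (Rinf x).
  apply: (ae_eq_sigma_algebra_preimage mR) => //.
  - by move=> D mD; have [] := Gg D mD.
  - by move=> D mD; exact: Gh.
  - by move=> A GA; rewrite Ehr//; have [] := gE A GA.
have gi : \forall x \ae nu, complex.Im (g x) = hi (Rinf x).
  apply: (ae_eq_sigma_algebra_preimage mR) => //.
  - by move=> D mD; have [] := Gg D mD.
  - by move=> D mD; exact: Gh.
  - by move=> A GA; rewrite Ehi//; have [] := gE A GA.
(* Integrability under the kernel for almost every T becomes a statement for almost every path,
   because [mu] is the image of [nu]. *)
have kr := ae_pushforward (ae_kernel_integrable kE ire).
have ki := ae_pushforward (ae_kernel_integrable kE iim).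
apply: filterS2 (filterI gr gi) (filterI kr ki) => x [xr xi] [xkr xki].
split; first by split.
by rewrite /cintegral -/(hr _) -/(hi _) -xr -xi; case: (g x).
Qed.
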